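(* Let $\mathbf q\in\mathcal Q^+$. For any $k\in\mathbb N$, $$\bar{\mathcal W}_k(\mathbf q):=\int_{\Omega_*}d\phi_{\mathbf q}(\eta)\,\mathcal W_k(\eta,0)=\frac{\bar\varepsilon(\mathbf q)-\bar\varepsilon(C_{k-1}\mathbf q)}{2\,\bar\varepsilon(\mathbf q)}.$$
   Context: $\mathbb N=\{1,2,\dots\}$, $0^0=1$. **Configurations.** $\Omega=\{\eta\in\{0,1\}^{\mathbb Z}:\lim_{x\to\infty}\frac1x\sum_{y=-x}^{0}\eta(y)<\frac12\}$. A site $x$ is a record of $\eta$ if $\sum_{y=z}^{x}(2\eta(y)-1)<0$ for all $z\le x$. $(s_\infty(\eta,i))_{i\in\mathbb Z}$ enumerates the records increasingly, $s_\infty(\eta,0)$ being the largest record $\le0$ ($s_\infty(\eta,i)=\infty$ if there are too few records on the right). $\Omega_*=\{\eta\in\Omega:|s_\infty(\eta,i)|<\infty\ \forall i\}$, $\Omega_r=\{\eta\in\Omega_*:s_\infty(\eta,0)=0\}$. **Seat numbers.** For $\eta$ with records unbounded below, $(\mathcal W_k(\eta,\cdot))_{k\in\mathbb N}$, $\mathcal W_k(\eta,\cdot):\mathbb Z\to\{0,1\}$, are the unique functions vanishing at every record and satisfying $\mathcal W_k(\eta,x)=\mathcal W_k(\eta,x-1)+\eta^{\uparrow}_k(x)-\eta^{\downarrow}_k(x)$ for all $x\in\mathbb Z$, where $\eta^{\uparrow}_k(x)=\eta(x)(1-\mathcal W_k(\eta,x-1))\prod_{j=1}^{k-1}\mathcal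 W_j(\eta,x-1)$ and $\eta^{\downarrow}_k(x)=(1-\eta(x))\mathcal W_k(\eta,x-1)\prod_{j=1}^{k-1}(1-\mathcal W_j(\eta,x-1))$. Define $\xi_k(\eta,\cdot)$ by $\xi_k(\eta,s_\infty(\eta,0))=0$ and $\xi_k(\eta,x)-\xi_k(\eta,x-1)=1-\sum_{j=1}^{k}(\eta^\uparrow_j(x)+\eta^\downarrow_j(x))$; $s_k(\eta,x)=\min\{y\in\mathbb Z:\xi_k(\eta,y)=x\}$; $\zeta_k(\eta,i)=\sum_{y=s_k(\eta,i)+1}^{s_k(\eta,i+1)}(\eta^{\uparrow}_k(y)-\eta^{\uparrow}_{k+1}(y))$. **Excursions.** An excursion of length $2n+1$, $n\in\mathbb Z_{\ge0}$, is $\varepsilon=(\varepsilon_0,\dots,\varepsilon_{2n})\in\{0,1\}^{2n+1}$ with $\varepsilon_0=0$, $\sum_{j=1}^{m}(2\varepsilon_j-1)\ge0$ for $1\le m<2n$, and $\sum_{j=1}^{2n}(2\varepsilon_j-1)=0$. $\mathcal E$ is the set of all excursions, $|\varepsilon|$ the length. $\iota(\varepsilon)\in\{0,1\}^{\mathbb Z}$ equals $\varepsilon_x$ for $0\le x\le|\varepsilon|-1$ and $0$ elsewhere. $\zeta_k(\varepsilon)=\sum_{i=0}^{\xi_k(\iota(\varepsilon),|\varepsilon|)-1}\zeta_k(\iota(\varepsilon),i)$. **Measures.** $\mathcal Q^+=\{\mathbf q=(q_k)_{k\in\mathbb N}\in[0,1)^{\mathbb N}:\sum_k kq_k<\infty\}$.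 For $\mathbf q\in\mathcal Q^+$, $\varphi_{\mathbf q}(\varepsilon)=\prod_{k\in\mathbb N}q_k^{\zeta_k(\varepsilon)}(1-q_k)^{1+2\sum_{\ell\in\mathbb N}\ell\zeta_{k+\ell}(\varepsilon)}$ is a probability measure on $\mathcal E$, and $\bar\varepsilon(\mathbf q)=\sum_\varepsilon|\varepsilon|\varphi_{\mathbf q}(\varepsilon)<\infty$. $(C_k\mathbf q)_\ell=q_\ell$ for $1\le\ell\le k$ and $0$ for $\ell>k$ ($C_0\mathbf q=0$). $\hat\phi_{\mathbf q}$ is the law (on $\Omega_r$) of the concatenation $\cdots\varepsilon_{-1}\varepsilon_0\varepsilon_1\cdots$, first letter of $\varepsilon_0$ at site $0$, of i.i.d. excursions with law $\varphi_{\mathbf q}$. With $(\tau_y\eta)(x)=\eta(x+y)$, $\phi_{\mathbf q}$ is the probability measure on $\Omega_*$ with $\int f\,d\phi_{\mathbf q}=\frac1{\bar\varepsilon(\mathbf q)}\int d\hat\phi_{\mathbf q}(\eta)\sum_{y=0}^{s_\infty(\eta,1)-1}f(\tau_y\eta)$. *)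

(* Defs.v *)
From HB Require Import structures.
From mathcomp Require Import all_boot all_order all_algebra.
From mathcomp Require Import all_classical all_reals all_analysis.
From mathcomp Require Import measurable_realfun.
Import Order.TTheory GRing.Theory Num.Theory.
Import numFieldNormedType.Exports.

Set Implicit Arguments.
Unset Strict Implicit.
Unset Printing Implicit Defensive.

Local Open Scope classical_set_scope.
Local Open Scope ring_scope.

(* Families indexed by {1, 2, ...} are functions on nat whose value at 0 is
   never used.  "The object such that P" is written xget x0 [set x | P x]; the
   default x0 only matters when there is no such object. *)

(* {0,1}^Z with the product sigma-algebra, generated by the one-site
   cylinders. *)
Definition cylinders : set (set (int -> bool)) :=
  [set A | exists x : int, A = [set eta : int -> bool | eta x]].
Notation config := (g_sigma_algebraType cylinders).

Definition shift (y : int) (eta : int -> bool) : int -> bool :=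
  fun x => eta (x + y).

Definition is_record (eta : int -> bool) (x : int) : Prop :=
  forall z : int, z <= x -> \sum_(y \in `[z, x]) (2 * (eta y)%:Z - 1) < 0.

Definition is_record_enum (eta : int -> bool) (s : int -> \bar int) : Prop :=
  [/\ forall x : int, is_record eta x <-> exists i, s i = x%:E,
      forall i j, i < j -> s j = +oo%E \/ (s i < s j)%E,
      (s 0%R <= 0%:E)%E & (0%:E < s 1%R)%E].

Definition s_inf (eta : int -> bool) : int -> \bar int :=
  xget (fun=> +oo%E) [set s | is_record_enum eta s].

Section seat_numbers.
Variables (eta : int -> bool) (W : nat -> int -> bool).

Definition arrow_up (k : nat) (x : int) : int :=
  (eta x)%:Z * (1 - (W k (x - 1))%:Z) * \prod_(1 <= j < k) (W j (x - 1))%:Z.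

Definition arrow_down (k : nat) (x : int) : int :=
  (1 - (eta x)%:Z) * (W k (x - 1))%:Z
    * \prod_(1 <= j < k) (1 - (W j (x - 1))%:Z).

Definition is_seat : Prop :=
  forall k : nat, (0 < k)%N ->
    (forall x, is_record eta x -> W k x = false) /\
    (forall x, (W k x)%:Z = (W k (x - 1))%:Z + arrow_up k x - arrow_down k x).

End seat_numbers.

Definition seat (eta : int -> bool) : nat -> int -> bool :=
  xget (fun _ _ => false) [set W | is_seat eta W].

Definition eta_up (eta : int -> bool) : nat -> int -> int :=
  arrow_up eta (seat eta).

Definition eta_down (eta : int -> bool) : nat -> int -> int :=
  arrow_down eta (seat eta).

Definition xi (k : nat) (eta : int -> bool) : int -> int :=
  xget (fun=> 0) [set f : int -> int | f (fine (s_inf eta 0)) = 0 /\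
    forall x, f x - f (x - 1) =
      1 - \sum_(1 <= j < k.+1) (eta_up eta j x + eta_down eta j x)].

Definition s_ (k : nat) (eta : int -> bool) (x : int) : int :=
  xget 0 [set y | xi k eta y = x /\ forall z, xi k eta z = x -> y <= z].

Definition zeta (k : nat) (eta : int -> bool) (i : int) : int :=
  \sum_(y \in `](s_ k eta i), (s_ k eta (i + 1))])
    (eta_up eta k y - eta_up eta k.+1 y).

(* With |e| = 2n+1, the indices 1 <= m < 2n are those below (size e).-1. *)
Definition is_excursion (e : seq bool) : bool :=
  let S m : int := \sum_(1 <= j < m.+1) (2 * (nth false e j)%:Z - 1) in
  [&& odd (size e), nth false e 0 == false,
      [forall m : 'I_(size e), (1 <= m < (size e).-1)%N ==> (0 <= S m)]
    & S (size e).-1 == 0].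

Record excursion := Excursion {
  letters :> seq bool;
  _ : is_excursion letters }.

HB.instance Definition _ := [isSub for letters].
HB.instance Definition _ := [Countable of excursion by <:].

Definition iota_exc (e : excursion) : int -> bool :=
  fun x => if x is Posz n then nth false e n else false.

Definition zeta_exc (k : nat) (e : excursion) : int :=
  \sum_(i \in `[0, (xi k (iota_exc e) (size e)%:Z)[) zeta k (iota_exc e) i.

Section measures.
Variable R : realType.
Implicit Type q : nat -> R.

Definition Qplus q : Prop :=
  (forall k, (0 < k)%N -> 0 <= q k < 1) /\
  (\sum_(1 <= k <oo) (k%:R * q k)%:E < +oo)%E.

(* Integer powers, so that 0 ^ 0 = 1.  The sum over l is finitely supported:
   zeta_exc k e = 0 for k large. *)
Definition exc_weight q (e : excursion) : R :=
  limn (fun n => \prod_(1 <= k < n)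
    (q k ^ zeta_exc k e *
     (1 - q k) ^ (1 + 2 * \sum_(l \in [set l : nat | (0 < l)%N])
                            l%:Z * zeta_exc (k + l) e))).

Definition mean_length q : R :=
  fine (\esum_(e in [set: excursion]) ((size e)%:R * exc_weight q e)%:E).

Definition truncate (k : nat) q : nat -> R :=
  fun l => if (l <= k)%N then q l else 0.

Definition left_density (eta : int -> bool) (n : nat) : R :=
  n%:R^-1 * \sum_(y \in `[(- n%:Z), 0]) ((eta y)%:R : R).

Definition Omega : set config := [set eta |
  exists2 l : R, l < 2^-1 & left_density eta @ \oo --> l].

Definition Omega_star : set config :=
  Omega `&` [set eta | forall i, s_inf eta i \is a fin_num].

Definition Omega_r : set config :=
  Omega_star `&` [set eta | s_inf eta 0 = 0%:E].

(* Site of the first letter of the i-th excursion (one of the two sums is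
   empty). *)
Definition start (e : int -> excursion) (i : int) : int :=
  \sum_(j \in `[0, i[) (size (e j))%:Z - \sum_(j \in `[i, 0[) (size (e j))%:Z.

(* Default letters beyond the end of e i are false, so they contribute no
   particle. *)
Definition concatenation (e : int -> excursion) : config :=
  fun x => `[< exists i (j : nat),
                 x = start e i + j%:Z /\ nth false (e i) j >].

(* excursion is countable and carries the discrete sigma-algebra. *)
Definition iid_excursions q d (T : measurableType d) (P : probability T R)
    (X : int -> T -> excursion) : Prop :=
  [/\ forall i (A : set excursion), measurable (X i @^-1` A),
      forall i e, P (X i @^-1` [set e]) = (exc_weight q e)%:E
    & forall (J : seq int) (A : int -> set excursion), uniq J ->
        P (\bigcap_(i in [set` J]) (X i @^-1` A i)) =
        (\prod_(i <- J) P (X i @^-1` A i))%E].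

Definition is_phi_hat q (phi_hat : probability config R) : Prop :=
  exists d (T : measurableType d) (P : probability T R)
         (X : int -> T -> excursion),
    iid_excursions q P X /\
    forall A : set config, measurable A ->
      phi_hat A = P [set t | A (concatenation (X ^~ t))].

Definition is_phi q (phi_hat phi : probability config R) : Prop :=
  phi Omega_star = 1%E /\
  forall f : config -> \bar R,
    measurable_fun Omega_star f ->
    (forall eta, Omega_star eta -> (0 <= f eta)%E) ->
    (\int[phi]_(eta in Omega_star) f eta =
     ((mean_length q)^-1)%:E *
     \int[phi_hat]_(eta in Omega_r)
        \sum_(y \in `[0%R, (fine (s_inf eta 1%R))[) f (shift y eta))%E.

End measures.

Arguments Omega_star : clear implicits.

(* Main.v *)
(* Call "skeleton" of an excursion the word obtained by deleting every
   letter that differs from the previous one.  This is the first step of the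
   box-ball hierarchy: seat [k.+1] of the excursion is seat [k] of the
   skeleton, [zeta_(k+1)] becomes [zeta_k], and the excursion is recovered from
   its skeleton by inserting [2 m] letters (plus one when the letter changes) in
   each of the gaps, where the sum of the [m]'s is [zeta_1].  Under [phi_q] the
   [m]'s are i.i.d. geometric of parameter [q_1] given the skeleton, whose law
   is [phi_(q_2, q_3, ...)].  The pair (number of sites where seat [k] is
   occupied, number of letter changes seen while seat [k] is occupied) is thus
   transformed by a linear map that depends only on [q_1], and so is the pair
   (length, number of letter changes).  By induction on [k], the expectations
   satisfy [2 E_q(occupation of seat k.+1) + E_(C_k q)(length) = E_q(length)];
   for [k = 0] seat 1 is the letter itself and half of the letters after the
   initial 0 are 1.

   The defining identity of [phi], applied to the constant 1, gives that the
   mean length is finite and that [phi_hat] is carried by [Omega_r], so that no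
   law of large numbers is needed; applied to the seat, it gives the mean
   number of occupied sites in the first excursion. *)

Require Import Defs.
From mathcomp Require Import all_boot all_order all_algebra.
From mathcomp Require Import all_classical all_reals all_analysis.
From mathcomp Require Import measurable_realfun.
From mathcomp Require Import zify ring lra.
Set Implicit Arguments.
Unset Strict Implicit.
Unset Printing Implicit Defensive.

(** * Words, carriers and skeletons *)

(** Ballot paths: with [true] as an up step and [false] as a down step, the path started at height
    [h] stays nonnegative and ends at 0. *)
Fixpoint dyck (h : nat) (w : seq bool) : bool :=
  if w is b :: w' then
    if b then dyck h.+1 w' else if h is h'.+1 then dyck h' w' else false
  else h == 0.

(** One site of the seat recursion: a ball takes the free seat of smallest number, an empty site
    frees the occupied seat of smallest number. *)
Definition step (c : nat -> bool) (b : bool) (k : nat) : bool :=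
  if b then c k || all c (iota 1 k.-1)
  else c k && has c (iota 1 k.-1).

Definition carrier (w : seq bool) : nat -> bool :=
  foldl step (fun=> false) w.

(** Here [p] is the letter before [w]. Comparison is with the previous letter of the original word,
    kept or not. *)
Fixpoint skeleton (p : bool) (w : seq bool) : seq bool :=
  if w is b :: w' then if b == p then b :: skeleton b w' else skeleton b w' else [::].

Fixpoint alternate (p : bool) (n : nat) : seq bool :=
  if n is n'.+1 then ~~ p :: alternate (~~ p) n' else [::].

(** The run inserted before [a] has the parity that brings the last letter to [a], so that [a]
    repeats its predecessor and survives in the skeleton. *)
Fixpoint inflate (p : bool) (w : seq bool) (ms : seq nat) : seq bool :=
  match w, ms with
  | a :: w', m :: ms' =>
      alternate p (m.*2 + (a != p)) ++ a :: inflate a w' ms'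
  | [::], m :: _ => alternate p m.*2
  | _, _ => [::]
  end.

(* [p] is the last letter read and [c] the number of letters deleted since the
   last one that was kept. *)
Fixpoint gaps (p : bool) (c : nat) (w : seq bool) : seq nat :=
  if w is b :: w' then
    if b == p then c./2 :: gaps b 0 w' else gaps b c.+1 w'
  else [:: c./2].

(* In the next three definitions [u] is the part already read and [w] the part
   to be read. *)
Definition occupation (V : seq bool -> nat) : seq bool -> seq bool -> nat :=
  fix occ u w := V u + if w is b :: w' then occ (rcons u b) w' else 0.

Definition turns (V : seq bool -> nat) : seq bool -> seq bool -> nat :=
  fix trn u w := if w is b :: w' then
    V u * (b != last false u) + trn (rcons u b) w' else 0.

Fixpoint weighted (V : seq bool -> nat) u w (ms : seq nat) : nat :=
  if ms is m :: ms' then V u * m +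
    if w is b :: w' then weighted V (rcons u b) w' ms' else 0
  else 0.

Lemma carrier_rcons w b : carrier (rcons w b) = step (carrier w) b.
Proof. by rewrite /carrier -cats1 foldl_cat. Qed.

Lemma skeleton_rcons p w b : skeleton p (rcons w b) =
  if b == last p w then rcons (skeleton p w) b else skeleton p w.
Proof.
elim: w p => [|a w IH] p /=; first by case: ifP.
by rewrite IH; do 2!case: ifP.
Qed.

Lemma carrier1 w : carrier w 1 = last false w.
Proof.
elim/last_ind: w => [//|w b IH].
by rewrite carrier_rcons last_rcons /step /= andbF orbT; case: b.
Qed.

(** By [carrier1], seat 1 holds the previous letter. A letter that differs from it is absorbed by
    seat 1 and leaves the other seats alone; an equal letter passes through and acts on seats 2, 3,
    ... as on a carrier without seat 1. The letters that pass are those kept by [skeleton]. *)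
Lemma carrierS w k : 0 < k -> carrier w k.+1 = carrier (skeleton false w) k.
Proof.
have iotaS (c : pred nat) j : 0 < j ->
    (all c (iota 1 j.+1.-1) = c 1 && all (c \o S) (iota 1 j.-1)) *
    (has c (iota 1 j.+1.-1) = c 1 || has (c \o S) (iota 1 j.-1)).
  by case: j => // j _; rewrite /= (iotaDl 1 1) all_map has_map.
elim/last_ind: w k => [//|w b IH] k k_gt0.
rewrite carrier_rcons skeleton_rcons {1}/step !(iotaS _ k k_gt0) carrier1 (IH k k_gt0).
have eqc : {in iota 1 k.-1, carrier w \o S =1 carrier (skeleton false w)}.
  by move=> j; rewrite mem_iota => /andP[j_gt0 _]; exact: IH.
rewrite (eq_in_all eqc) (eq_in_has eqc).
case: b; case: (last false w) => /=; rewrite ?orbF ?andbT ?carrier_rcons //.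
Qed.

(** The invariant is that the height of the path is the height of its skeleton plus the last letter
    read: a letter that differs from its predecessor changes only the second term, a repeated one
    only the first. *)
Lemma dyck_skeleton (p : bool) h w :
  dyck (h + p) w = dyck h (skeleton p w) && (last p w == false).
Proof.
elim: w p h => [|b w IH] p h /=; first by rewrite addn_eq0 eqb0; case: p.
case: b p => [] [] /=.
- by rewrite -[(h + 1).+1]/(h.+1 + true) IH.
- by rewrite addn0 -addn1 (IH true).
- by rewrite addn1 -[h in LHS]addn0 (IH false).
- by case: h => //= h; rewrite addn0 -[h in LHS]addn0 (IH false).
Qed.

Lemma dyck_last h w : dyck h w -> last false w = false.
Proof. by rewrite -[h]addn0 (dyck_skeleton false) => /andP[_ /eqP]. Qed.

Lemma alternate_cat p m n : alternate p (m + n) =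
  alternate p m ++ alternate (p (+) odd m) n.
Proof. by elim: m p => [|m IH] p /=; rewrite ?addbF // IH addbN addNb. Qed.

Lemma skeleton_alternate p n w :
  skeleton p (alternate p n ++ w) = skeleton (p (+) odd n) w.
Proof.
elim: n p => [|n IH] p /=; first by rewrite addbF.
by rewrite IH addbN addNb; case: (p).
Qed.

Lemma last_alternate p n : last p (alternate p n) = p (+) odd n.
Proof. by elim: n p => [|n IH] p /=; rewrite ?addbF // IH addbN addNb. Qed.

(** An inserted run alternates from the letter before it, so all of it is deleted. *)
Lemma skeleton_inflate p w ms :
  size ms = (size w).+1 -> skeleton p (inflate p w ms) = w.
Proof.
elim: w p ms => [|a w IH] p [|m ms] //= [] sz_ms.
  by rewrite -[alternate _ _]cats0 skeleton_alternate.
rewrite skeleton_alternate oddD odd_double addFb oddb.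
have -> : p (+) (a != p) = a by case: (a) (p) => [] [].
by rewrite /= eqxx IH.
Qed.

Lemma last_inflate p w ms :
  size ms = (size w).+1 -> last p (inflate p w ms) = last p w.
Proof.
elim: w p ms => [|a w IH] p [|m ms] //= [] sz_ms.
  by rewrite last_alternate odd_double addbF.
by rewrite last_cat /= IH.
Qed.

Lemma gaps_alternate p c n w :
  gaps p c (alternate p n ++ w) = gaps (p (+) odd n) (c + n) w.
Proof.
elim: n p c => [|n IH] p c /=; first by rewrite addbF addn0.
have -> : (~~ p == p) = false by case: (p).
by rewrite IH addbN addNb addSnnS.
Qed.

Lemma gaps_inflate p w ms :
  size ms = (size w).+1 -> gaps p 0 (inflate p w ms) = ms.
Proof.
elim: w p ms => [|a w IH] p [|m ms] //= [] sz_ms.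
  move/size0nil: sz_ms => ->.
  by rewrite -[alternate _ _]cats0 gaps_alternate /= add0n doubleK.
rewrite gaps_alternate oddD odd_double addFb oddb add0n.
have -> : p (+) (a != p) = a by case: (a) (p) => [] [].
rewrite /= eqxx IH // addnC; congr cons.
by case: (a != p); rewrite ?add0n ?add1n /= ?uphalf_double ?doubleK.
Qed.

Lemma size_gaps p c w : size (gaps p c w) = (size (skeleton p w)).+1.
Proof. by elim: w p c => [//|b w IH] p c /=; case: ifP => _ /=; rewrite IH. Qed.

(** The hypothesis makes the trailing deleted run even, the only kind that [inflate] writes after
    the last letter. *)
Lemma last_skeleton_gaps p w : last p (skeleton p w) = last p w ->
  inflate p (skeleton p w) (gaps p 0 w) = w.
Proof.
(* Generalized to a reading in which [c] letters of the current run are already deleted; the last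
   letter read is then [p (+) odd c]. *)
suff H c : last p (skeleton (p (+) odd c) w) = last (p (+) odd c) w ->
    inflate p (skeleton (p (+) odd c) w) (gaps (p (+) odd c) c w)
    = alternate p c ++ w.
  by move: (H 0); rewrite addbF.
elim: w p c => [|b w IH] p c /=.
  rewrite cats0 => h.
  have /even_halfK -> // : ~~ odd c by case: (p) (odd c) h => [] [].
case: (b =P p (+) odd c) => [->|bp] /=.
  move=> h; have {IH} := IH (p (+) odd c) 0; rewrite addbF => -> //=.
  congr (alternate p _ ++ _).
  by rewrite -[RHS]odd_double_half addnC; case: (p) (odd c) => [] [].
have {bp} -> : b = p (+) odd c.+1 by rewrite /=; case: b p (odd c) bp {IH} => [] [] [].
by move=> h; rewrite IH // -addn1 alternate_cat -catA /= addn1 addbN.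
Qed.

Section skeleton_statistics.
Variable V : seq bool -> nat.
Let V' u := V (skeleton false u).

(** The skeleton does not grow along an alternating run, so [V'] stays constant there. The same
    holds for [turns], every letter of the run being a change. *)
Lemma occupation_alternate x n w :
  occupation V' x (alternate (last false x) n ++ w) =
  n * V' x + occupation V' (x ++ alternate (last false x) n) w.
Proof.
elim: n x => [|n IH] x /=; first by rewrite cats0.
have {IH} := IH (rcons x (~~ last false x)).
rewrite last_rcons cat_rcons => ->.
rewrite /V' skeleton_rcons; case: ifP => [|_]; first by case: (last _ _).
by rewrite mulSn addnA.
Qed.

Lemma turns_alternate x n w :
  turns V' x (alternate (last false x) n ++ w) =
  n * V' x + turns V' (x ++ alternate (last false x) n) w.
Proof.
elim: n x => [|n IH] x /=; first by rewrite cats0.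
have {IH} := IH (rcons x (~~ last false x)).
rewrite last_rcons cat_rcons => ->.
rewrite /V' skeleton_rcons; case: ifP => [|_]; first by case: (last _ _).
by rewrite mulSn addnA; case: (last _ _); rewrite /= muln1.
Qed.

Lemma skeleton_cat_alternate x n :
  skeleton false (x ++ alternate (last false x) n) = skeleton false x.
Proof.
elim: n x => [|n IH] x /=; first by rewrite cats0.
have {IH} := IH (rcons x (~~ last false x)).
by rewrite last_rcons cat_rcons => ->; rewrite skeleton_rcons; case: (last _ _).
Qed.

Lemma last_cat_alternate x n :
  last false (x ++ alternate (last false x) n) = last false x (+) odd n.
Proof. by rewrite last_cat last_alternate. Qed.

(* Here [u] is the skeleton of the letters [x] already read. *)
Lemma statistics_inflate x u w ms : size ms = (size w).+1 ->
    skeleton false x = u -> last false u = last false x ->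
  (occupation V' x (inflate (last false x) w ms) =
    occupation V u w + turns V u w + (weighted V u w ms).*2) *
  (turns V' x (inflate (last false x) w ms) =
    turns V u w + (weighted V u w ms).*2).
Proof.
elim: w x u ms => [|a w IH] x u [|m ms] //= [] sz_ms xu lu.
  have := occupation_alternate x m.*2 [::]; rewrite cats0 => ->.
  have := turns_alternate x m.*2 [::]; rewrite cats0 => -> /=.
  by rewrite /V' skeleton_cat_alternate xu; split; lia.
(* The run before [a] has [2 m] letters, plus one if [a] is a turn of the skeleton; [a] itself
   repeats the letter before it, so it adds a site but no turn. *)
rewrite occupation_alternate turns_alternate /=.
set y := x ++ _.
have ly : last false y = a.
  rewrite last_cat_alternate oddD odd_double.
  by case: (a) (last false x) => [] [].
have py : skeleton false (rcons y a) = rcons u a.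
  by rewrite skeleton_rcons ly eqxx skeleton_cat_alternate xu.
have := IH (rcons y a) (rcons u a) ms sz_ms py; rewrite !last_rcons.
move=> /(_ erefl) [-> ->].
rewrite /V' skeleton_cat_alternate xu ly eqxx lu.
by split; lia.
Qed.

End skeleton_statistics.

Lemma occupation1 u w : occupation (fun=> 1) u w = (size w).+1.
Proof. by elim: w u => //= b w IH u; rewrite IH. Qed.

Lemma dyck_count h w : dyck h w -> h + (count id w).*2 = size w.
Proof.
elim: w h => [|[] w IH] h /=; first by move/eqP->.
  by move/IH <-; lia.
by case: h => //= h /IH <-; lia.
Qed.

Lemma occupation_last u w :
  occupation (fun x => last false x) u w = last false u + count id w.
Proof.
elim: w u => [|b w IH] u /=; first by rewrite !addn0.
by rewrite IH last_rcons.
Qed.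

(** The turns counted on the left go from [true] to [false]; they alternate with the opposite ones,
    up to boundary terms. *)
Lemma turns_last u w : (turns (fun x => last false x) u w).*2 + last false (u ++ w)
  = last false u + turns (fun=> 1) u w.
Proof.
elim: w u => [|b w IH] u /=; first by rewrite cats0 addn0.
have := IH (rcons u b); rewrite cat_rcons last_rcons.
by case: b (last false u) => [] []; lia.
Qed.

Lemma size_skeleton u w :
  size w = size (skeleton (last false u) w) + turns (fun=> 1) u w.
Proof.
elim: w u => [|b w IH] u //=.
have := IH (rcons u b); rewrite last_rcons.
by case: b (last false u) {IH} => [] [] /=; lia.
Qed.

Lemma weighted1 u w ms :
  size ms = (size w).+1 -> weighted (fun=> 1) u w ms = sumn ms.
Proof.
elim: w u ms => [|a w IH] u [|m ms] //= [].
  by move/size0nil ->; rewrite /= mul1n.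
by move=> sz; rewrite IH // mul1n.
Qed.

Lemma dyck_skeleton0 w : dyck 0 w -> dyck 0 (skeleton false w).
Proof. by rewrite -{1}[0](addn0 0) (dyck_skeleton false) => /andP[]. Qed.

Lemma last_skeleton0 w : dyck 0 w -> last false (skeleton false w) = last false w.
Proof. by move=> dw; rewrite (dyck_last (dyck_skeleton0 dw)) (dyck_last dw). Qed.

Lemma inflate_skeleton w : dyck 0 w -> inflate false (skeleton false w) (gaps false 0 w) = w.
Proof. by move=> dw; apply/last_skeleton_gaps/last_skeleton0. Qed.

Lemma dyck_inflate w ms : size ms = (size w).+1 ->
  dyck 0 w -> dyck 0 (inflate false w ms).
Proof.
move=> sz dw; rewrite -{1}[0](addn0 0) (dyck_skeleton false) skeleton_inflate // dw.
by rewrite last_inflate // (dyck_last dw).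
Qed.

Lemma turns_gaps w : dyck 0 w ->
  turns (fun=> 1) [::] w =
  turns (fun=> 1) [::] (skeleton false w) + (sumn (gaps false 0 w)).*2.
Proof.
move=> dw; have sz := size_gaps false 0 w.
have [_] := @statistics_inflate (fun=> 1) [::] [::] _ _ sz erefl erefl.
by rewrite /= inflate_skeleton // weighted1.
Qed.

(** The first letter of a nonempty ballot word is [true], hence deleted. Inductions along skeletons
    terminate for this reason. *)
Lemma size_skeleton_lt w : dyck 0 w -> w != [::] -> size (skeleton false w) < size w.
Proof.
case: w => [//|[] w] //= _ _; rewrite ltnS.
by rewrite [leqRHS](size_skeleton [:: true]) leq_addr.
Qed.

(** The number of solitons of size [k]: [k - 1] skeleton steps remove the smaller ones, and the gaps
    then count those that vanish next. [zeta_excE] identifies it with [zeta_exc]. *)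
Definition solitons (k : nat) (w : seq bool) : nat :=
  sumn (gaps false 0 (iter k.-1 (skeleton false) w)).

Lemma solitonsS k w : 0 < k -> solitons k.+1 w = solitons k (skeleton false w).
Proof. by case: k => // k _; rewrite /solitons /= -iterSr. Qed.

Lemma solitons_gt_size k w : dyck 0 w -> size w < k -> solitons k w = 0.
Proof.
elim: k w => [//|[|k] IH] w dw; first by case: w dw.
rewrite ltnS => sz; rewrite solitonsS //; apply: IH; first exact: dyck_skeleton0.
case: (eqVneq w [::]) => [-> //|/(size_skeleton_lt dw)/leq_trans]; exact.
Qed.

(** A skeleton step shortens every soliton by one and deletes one letter per turn, with two turns
    per soliton. Any bound [n] on the length will do, by [solitons_gt_size]. *)
Lemma sum_solitons n w : dyck 0 w -> size w <= n ->
  ((\sum_(1 <= k < n.+1) solitons k w).*2 = turns (fun=> 1) [::] w) *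
  ((\sum_(1 <= k < n.+1) k * solitons k w).*2 = size w).
Proof.
elim: n w => [|n IH] w dw szw; first by case: w szw {dw}; rewrite // !big_geq.
have le_skeleton : size (skeleton false w) <= n.
  case: (eqVneq w [::]) => [-> //|/(size_skeleton_lt dw) h].
  by rewrite -ltnS (leq_trans h).
have [IH1 IH2] := IH _ (dyck_skeleton0 dw) le_skeleton.
have s1 : solitons 1 w = sumn (gaps false 0 w) by [].
have sumS F : \sum_(1 <= k < n.+2) F k = F 1 + \sum_(1 <= k < n.+1) F k.+1.
  by rewrite big_ltn // big_add1.
rewrite !sumS.
rewrite (eq_big_nat _ _ (F2 := fun k => solitons k (skeleton false w))); last first.
  by move=> k /andP[? _]; rewrite solitonsS.
have -> : \sum_(1 <= k < n.+1) k.+1 * solitons k.+1 w =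
    \sum_(1 <= k < n.+1) k * solitons k (skeleton false w) +
    \sum_(1 <= k < n.+1) solitons k (skeleton false w).
  rewrite -big_split /=; apply: eq_big_nat => k /andP[? _].
  by rewrite solitonsS // mulSn addnC.
have := turns_gaps dw; have /= := size_skeleton [::] w.
by rewrite s1; split; lia.
Qed.

Definition ups (k : nat) : seq bool -> seq bool -> nat :=
  fix up u w := if w is b :: w' then
    [&& b, ~~ carrier u k & all (carrier u) (iota 1 k.-1)] + up (rcons u b) w'
  else 0.

Lemma upsS k u w : 0 < k ->
  ups k.+1 u w = ups k (skeleton false u) (skeleton (last false u) w).
Proof.
move=> k_gt0; elim: w u => [//|b w IH] u /=.
rewrite IH skeleton_rcons last_rcons carrierS //.
have -> : all (carrier u) (iota 1 k) =
    last false u && all (carrier (skeleton false u)) (iota 1 k.-1).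
  case: k k_gt0 {IH} => // k _.
  rewrite /= carrier1 (iotaDl 1 1) all_map; congr (_ && _).
  by apply: eq_in_all => j; rewrite mem_iota => /andP[? _] /=; rewrite carrierS.
by case: b (last false u) => [] [] //=; rewrite ?andbF.
Qed.

Lemma ups1 u w :
  (ups 1 u w).*2 + last false u = turns (fun=> 1) u w + last false (u ++ w).
Proof.
elim: w u => [|b w IH] u /=; first by rewrite cats0.
have := IH (rcons u b); rewrite cat_rcons last_rcons carrier1.
by case: b (last false u) => [] []; lia.
Qed.

(** Skeletons reduce this to [k = 1]. Seat 1 is then filled once per two turns of the word, seat 2
    once per two turns of its skeleton, and the numbers of turns differ by twice the sum of the
    gaps. *)
Lemma ups_solitons k w : 0 < k -> dyck 0 w ->
  ups k [::] w = ups k.+1 [::] w + solitons k w.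
Proof.
elim: k w => [//|[|k] IH] w _ dw; last first.
  rewrite (@upsS k.+1) // (@upsS k.+2) // solitonsS // IH //.
  exact: dyck_skeleton0.
rewrite (@upsS 1) //=; have /= := ups1 [::] w; have /= := ups1 [::] (skeleton false w).
rewrite last_skeleton0 // (dyck_last dw); have := turns_gaps dw.
by rewrite /solitons /=; lia.
Qed.

Import Order.TTheory GRing.Theory Num.Theory.
Import numFieldNormedType.Exports.
Local Open Scope classical_set_scope.
Local Open Scope ring_scope.

(** * Records and seats *)

Lemma fsbig_itvco (T : Type) (idx : T) (op : Monoid.com_law idx)
    (a : int) (n : nat) (F : int -> T) :
  \big[op/idx]_(y \in `[a, a + n%:Z[) F y = \big[op/idx]_(0 <= i < n) F (a + i%:Z).
Proof.
rewrite big_mkord (fsbig_ord op n (fun i => F (a + i%:Z))).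
apply: (reindex_fsbig (fun i : nat => a + i%:Z)); split.
- by move=> i /= ni; rewrite in_itv /=; lia.
- by move=> i j _ _ /=; lia.
- move=> y /=; rewrite in_itv /= => h; exists `|y - a|%N => /=; lia.
Qed.

Lemma itv_int_cc (a b : int) : [set` `[a, b]] = [set` `[a, b + 1[].
Proof. by apply/seteqP; split=> y /=; rewrite !in_itv /=; lia. Qed.

Lemma itv_int_oc (a b : int) : [set` `]a, b]] = [set` `[a + 1, b + 1[].
Proof. by apply/seteqP; split=> y /=; rewrite !in_itv /=; lia. Qed.

Definition word (eta : int -> bool) (a : int) (n : nat) : seq bool :=
  mkseq (fun i => eta (a + i%:Z)) n.

Definition height (u : seq bool) : int := \sum_(b <- u) (2 * b%:Z - 1).

Lemma height_cat u v : height (u ++ v) = height u + height v.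
Proof. exact: big_cat. Qed.

Lemma height_cons b u : height (b :: u) = (2 * b%:Z - 1) + height u.
Proof. exact: big_cons. Qed.

Lemma height_nil : height [::] = 0.
Proof. exact: big_nil. Qed.

Lemma size_word eta a n : size (word eta a n) = n.
Proof. exact: size_mkseq. Qed.

Lemma nth_word eta a n i : (i < n)%N -> nth false (word eta a n) i = eta (a + i%:Z).
Proof. exact: nth_mkseq. Qed.

Lemma word_cat eta a m n :
  word eta a (m + n) = word eta a m ++ word eta (a + m%:Z) n.
Proof.
rewrite /word /mkseq iotaD map_cat add0n; congr (_ ++ _).
rewrite -{1}[m]addn0 iotaDl -map_comp; apply: eq_map => i /=.
by rewrite PoszD addrA.
Qed.

Lemma word1 eta a : word eta a 1 = [:: eta a].
Proof. by rewrite /word /mkseq /= addr0. Qed.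

Lemma wordS eta a n : word eta a n.+1 = eta a :: word eta (a + 1) n.
Proof. by rewrite -add1n word_cat word1. Qed.

Lemma word_rcons eta a n :
  word eta a n.+1 = rcons (word eta a n) (eta (a + n%:Z)).
Proof. by rewrite -addn1 word_cat word1 cats1. Qed.

Lemma take_word eta a m n : (m <= n)%N -> take m (word eta a n) = word eta a m.
Proof.
move=> mn; rewrite -(subnKC mn) word_cat take_size_cat //.
by rewrite size_word.
Qed.

Lemma height_parity u : exists n, height u + (size u)%:Z = 2 * n.
Proof.
elim: u => [|b u [n IH]]; first by exists 0; rewrite height_nil.
by exists (n + b%:Z); rewrite height_cons /=; lia.
Qed.

Lemma dyckP h w : dyck h w <->
  (forall n, (n <= size w)%N -> 0 <= h%:Z + height (take n w)) /\
  h%:Z + height w = 0.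
Proof.
elim: w h => [|b w IH] h /=.
  rewrite height_nil addr0; split=> [/eqP ->|[_ [->]]] //.
have tl h' : h'%:Z = h%:Z + (2 * b%:Z - 1) ->
    dyck h' w <-> (forall n, (n <= (size w).+1)%N ->
      0 <= h%:Z + height (take n (b :: w))) /\ h%:Z + height (b :: w) = 0.
  move=> hh'; rewrite IH height_cons addrA -hh'; split=> -[H ->]; split=> //.
    by case=> [|n] /= nw; rewrite ?height_nil ?height_cons; [lia|have := H n nw; lia].
  by move=> n nw; have := H n.+1 nw; rewrite /= height_cons addrA -hh'.
case: b tl => tl; first by apply: tl; lia.
case: h tl => [|h] tl; last by apply: tl; lia.
split; first by [].
by case=> /(_ 1%N isT); rewrite /= take0 height_cons height_nil.
Qed.

Lemma excursionP s : is_excursion s <-> exists2 w, s = false :: w & dyck 0 w.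
Proof.
have sumE b w m : (m <= size w)%N ->
    \sum_(1 <= j < m.+1) (2 * (nth false (b :: w) j)%:Z - 1) = height (take m w).
  move=> mw; rewrite big_add1 /= /height (big_nth false) size_take.
  have -> : (if (m < size w)%N then m else size w) = m by case: ifP; lia.
  by apply: eq_big_nat => i /andP[_ im]; rewrite nth_take.
split.
  case: s => [//|b w] /and4P[_ /= /eqP -> /forallP H /eqP].
  rewrite sumE // take_size => h0; exists w => //; apply/dyckP.
  split; last by rewrite add0r.
  (* The inequalities in [is_excursion] concern neither the empty prefix nor the full one; both have
     height 0. *)
  move=> n; rewrite leq_eqVlt => /predU1P[->|nw].
    by rewrite take_size h0.
  case: n nw => [|n] nw; first by rewrite take0 height_nil.
  have nw' : (n.+1 < (size w).+1)%N by rewrite ltnS ltnW.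
  have := implyP (H (Ordinal nw')); rewrite /= nw sumE ?(ltnW nw) //.
  by rewrite add0r; apply.
move=> [w -> /dyckP[H h0]]; rewrite !add0r in h0.
apply/and4P; split => //=.
(* A word of height 0 has even length, so the excursion has odd length. *)
- have [n] := height_parity w; rewrite h0; lia.
- apply/forallP => m; apply/implyP => /andP[_ /ltnW mw].
  by rewrite (sumE _ _ _ mw); have := H m mw; rewrite add0r.
- by rewrite sumE // take_size h0.
Qed.

Lemma record_sumE (eta : int -> bool) (z x : int) : z <= x ->
  \sum_(y \in `[z, x]) (2 * (eta y)%:Z - 1) = height (word eta z (absz (x - z)%R).+1).
Proof.
move=> zx; rewrite itv_int_cc (_ : x + 1 = z + (absz (x - z)%R).+1%:Z); last by lia.
rewrite fsbig_itvco /height /word /mkseq big_map.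
by rewrite /index_iota subn0.
Qed.

(* The partial sums are only tested down to [a], which allows an induction on
   the excursions of a bi-infinite concatenation from left to right. *)
Definition record_from (eta : int -> bool) (a x : int) : Prop :=
  forall z, a <= z <= x -> height (word eta z (absz (x - z)%R).+1) < 0.

Lemma recordE eta x : is_record eta x <-> forall a, record_from eta a x.
Proof.
split=> [H a z /andP[_ zx]|H z zx]; first by rewrite -record_sumE //; exact: H.
by rewrite record_sumE //; apply: (H z); rewrite lexx.
Qed.

Lemma record_letter eta x : is_record eta x -> eta x = false.
Proof.
move/recordE/(_ x x); rewrite lexx => /(_ isT).
by rewrite subrr word1 height_cons height_nil; case: (eta x).
Qed.

Lemma height_split eta a b c : a <= b -> b <= c ->
  height (word eta a (absz (c - a)%R)) =
  height (word eta a (absz (b - a)%R)) + height (word eta b (absz (c - b)%R)).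
Proof.
move=> ab bc; rewrite -height_cat.
have -> : absz (c - a)%R = ((absz (b - a)%R) + (absz (c - b)%R))%N by lia.
by rewrite word_cat; congr (height (_ ++ word _ _ _)); lia.
Qed.

(** A sum begun at or before [r] is negative up to [r], then gains 0 and finally -1. One begun after
    [r] is the total -1 minus a prefix height, which is nonnegative. *)
Lemma record_after eta a r n : record_from eta a r ->
    dyck 0 (word eta (r + 1) n) -> eta (r + 1 + n%:Z) = false ->
  record_from eta a (r + 1 + n%:Z).
Proof.
move=> rr /dyckP[H h0] last_false z /andP[az zx].
rewrite size_word in H; rewrite add0r in h0.
have [zr|rz] := leP z r.
  rewrite (_ : (absz ( _ - z)%R).+1 = (absz ((r + 1 + n%:Z + 1) - z)%R)); last by lia.
  rewrite (@height_split _ _ (r + 1)); [|lia|lia].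
  rewrite (_ : (absz ((r + 1 + n%:Z + 1) - (r + 1))%R) = n.+1); last by lia.
  rewrite word_rcons -cats1 height_cat h0 last_false height_cons height_nil.
  by have := rr z; rewrite az zr (_ : (absz (r - z)%R).+1 = (absz (r + 1 - z)%R))%N; lia.
rewrite (_ : (absz ( _ - z)%R).+1 = (absz ((r + 1 + n%:Z + 1) - z)%R)); last by lia.
have := @height_split eta (r + 1) z (r + 1 + n%:Z + 1).
rewrite (_ : (absz ((r + 1 + n%:Z + 1) - (r + 1))%R) = n.+1); last by lia.
rewrite word_rcons -cats1 height_cat h0 last_false height_cons height_nil.
have := H (absz (z - (r + 1))%R); rewrite take_word; lia.
Qed.

Lemma not_record eta r m n : (m < n)%N -> dyck 0 (word eta (r + 1) n) ->
  ~ is_record eta (r + 1 + m%:Z).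
Proof.
move=> mn /dyckP[/(_ m.+1)]; rewrite size_word take_word // => /(_ mn) H _.
move=> /recordE/(_ (r + 1) (r + 1)).
rewrite (_ : (absz (r + 1 + m%:Z - (r + 1))%R).+1 = m.+1); last by lia.
by move=> H'; lia.
Qed.

(** A shortest prefix of negative height would end at a record: sums begun inside it are at most its
    height, and a sum begun at or before [r] adds a negative term. *)
Lemma no_record_height eta r n : is_record eta r ->
    (forall m, (m < n)%N -> ~ is_record eta (r + 1 + m%:Z)) ->
  forall m, (m <= n)%N -> 0 <= height (word eta (r + 1) m).
Proof.
move=> rr nrec m; elim/ltn_ind: m => m IH mn.
rewrite leNgt; apply/negP => hm.
case: m mn hm IH => [|m] mn hm IH; first by rewrite height_nil in hm.
apply: (nrec m) => //; apply/recordE => a z /andP[_ zm].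
rewrite (_ : (absz ( _ - z)%R).+1 = (absz ((r + 1 + m%:Z + 1) - z)%R)); last by lia.
have e1 : absz ((r + 1 + m%:Z + 1) - (r + 1))%R = m.+1 by lia.
have [zr|rz] := leP z r.
  rewrite (@height_split _ _ (r + 1)) ?e1; [|lia|lia].
  have := (recordE _ _).1 rr z z.
  by rewrite (_ : (absz (r - z)%R).+1 = (absz (r + 1 - z)%R))%N; lia.
have := @height_split eta (r + 1) z (r + 1 + m%:Z + 1); rewrite e1.
by have := IH (absz (z - (r + 1))%R); lia.
Qed.

(** The height is nonnegative by [no_record_height], and the record at the end forces the total to
    be at most 0. *)
Lemma between_records eta r n : is_record eta r -> is_record eta (r + 1 + n%:Z) ->
    (forall m, (m < n)%N -> ~ is_record eta (r + 1 + m%:Z)) ->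
  dyck 0 (word eta (r + 1) n).
Proof.
move=> rr rr' nrec; have H := no_record_height rr nrec.
apply/dyckP; rewrite size_word; split=> [m mn|].
  by rewrite take_word // add0r; exact: H.
have := (recordE _ _).1 rr' (r + 1) (r + 1).
rewrite (_ : (absz (r + 1 + n%:Z - (r + 1))%R).+1 = n.+1); last by lia.
rewrite word_rcons -cats1 height_cat (record_letter rr') height_cons height_nil.
by have := H n (leqnn n); lia.
Qed.

Lemma is_record_shift y eta x : is_record (Defs.shift y eta) x <-> is_record eta (x + y).
Proof.
have shiftE z n : word (Defs.shift y eta) z n = word eta (z + y) n.
  by apply: eq_mkseq => i; rewrite /Defs.shift; congr eta; lia.
split=> /recordE H; apply/recordE => a z zx.
  have := H (a - y) (z - y); rewrite shiftE subrK.
  by rewrite (_ : x - (z - y) = x + y - z); [apply|]; lia.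
have := H (a + y) (z + y); rewrite shiftE.
by rewrite (_ : x + y - (z + y) = x - z); [apply|]; lia.
Qed.

Lemma word_shift y eta x n : word (Defs.shift y eta) x n = word eta (x + y) n.
Proof. by apply: eq_mkseq => i; rewrite /Defs.shift; congr eta; lia. Qed.

Lemma carrier_dyck w k : (0 < k)%N -> dyck 0 w -> carrier w k = false.
Proof.
elim: k w => [//|[|k] IH] w _ dw; first by rewrite carrier1 (dyck_last dw).
by rewrite carrierS // IH // dyck_skeleton0.
Qed.

Lemma prod_all (c : nat -> bool) k :
  \prod_(1 <= j < k) (c j)%:Z = (all c (iota 1 k.-1))%:Z.
Proof.
rewrite /index_iota subn1; elim: (iota _ _) => [|j s IH] /=; first by rewrite big_nil.
by rewrite big_cons IH; case: (c j); rewrite ?mul1r ?mul0r.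
Qed.

Lemma prod_has (c : nat -> bool) k :
  \prod_(1 <= j < k) (1 - (c j)%:Z) = (~~ has c (iota 1 k.-1))%:Z.
Proof.
rewrite -all_predC -(prod_all (predC c)); apply: eq_bigr => j _ /=.
by case: (c j).
Qed.

Lemma arrow_step (eta : int -> bool) (W : nat -> int -> bool) k (x : int) :
  (W k (x - 1))%:Z + arrow_up eta W k x - arrow_down eta W k x =
  (step (fun j => W j (x - 1)) (eta x) k)%:Z.
Proof.
rewrite /arrow_up /arrow_down (prod_all (fun j => W j (x - 1))).
rewrite (prod_has (fun j => W j (x - 1))) /step.
by case: (eta x); case: (W k _); case: (all _ _); case: (has _ _).
Qed.

(** * Existence and computation of the seat numbers *)

Definition records_below (eta : int -> bool) : Prop :=
  forall x, exists2 y, y <= x & is_record eta y.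

Lemma last_record eta x : records_below eta -> exists n : nat,
  is_record eta (x - n%:Z) /\ forall m, (m < n)%N -> ~ is_record eta (x - m%:Z).
Proof.
move=> /(_ x)[y yx ry].
have ex : exists n : nat, `[< is_record eta (x - n%:Z) >].
  by exists (absz (x - y)%R); apply/asboolP; rewrite (_ : x - _ = y) //; lia.
case: (ex_minnP ex) => n /asboolP rn nmin; exists n; split=> // m mn rm.
by have := nmin m (asboolT rm); lia.
Qed.

Lemma step_ext c c' b k : {in iota 1 k.-1, c =1 c'} -> c k = c' k ->
  step c b k = step c' b k.
Proof. by move=> cc' ck; rewrite /step ck (eq_in_all cc') (eq_in_has cc'). Qed.

(** The seats at [x] are those filled by the letters read since the last record, from an empty
    carrier. The carrier is empty again just before the next record, by [between_records] and
    [carrier_dyck], so the recursion also holds across records. *)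
Lemma seat_exists eta : records_below eta -> exists W, is_seat eta W.
Proof.
move=> below; have [r rP] := choice (fun x => last_record x below).
pose W k x := carrier (word eta (x - (r x)%:Z + 1) (r x)) k.
have r_rec x : is_record eta x -> r x = 0%N.
  move=> rx; have [_ nr] := rP x; case: (r x) nr => // n /(_ 0%N isT).
  by rewrite subr0.
have r_uniq x n : is_record eta (x - n%:Z) ->
    (forall m, (m < n)%N -> ~ is_record eta (x - m%:Z)) -> r x = n.
  move=> rn nn; have [rr nr] := rP x.
  by case: (ltngtP (r x) n) => // [/nn|/nr].
exists W => k k_gt0; split=> x; first by move=> rx; rewrite /W (r_rec x rx).
rewrite arrow_step; congr (_%:Z : int).
have [rr nr] := rP (x - 1).
have [rx|nrx] := pselect (is_record eta x).
  suff Wk0 : W k (x - 1) = false.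
    by rewrite {1}/W (r_rec x rx) /step (record_letter rx) Wk0.
  apply: carrier_dyck => //; apply: between_records => //.
    by rewrite (_ : _ + _ = x) //; lia.
  move=> m mr; rewrite (_ : _ + _ = x - 1 - (r (x - 1)%R - m.+1)%N%:Z); last by lia.
  by apply: nr; lia.
have er : r x = (r (x - 1)).+1.
  apply: r_uniq => [|[|m] mr]; last 2 first.
  - by rewrite subr0.
  - by have := nr m mr; rewrite (_ : x - 1 - m%:Z = x - m.+1%:Z) //; lia.
  by move: rr; rewrite (_ : _ - _ = x - (r (x - 1)).+1%:Z) //; lia.
rewrite /W er word_rcons (_ : x - _ + 1 = x - 1 - (r (x - 1))%:Z + 1); last by lia.
by rewrite carrier_rcons; congr (step _ (eta _) _); lia.
Qed.

(** The zero value at a record and the recursion determine everything to its right, so the choice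
    made by [xget] has no influence. *)
Lemma seatE eta x n k : records_below eta -> is_record eta x -> (0 < k)%N ->
  seat eta k (x + n%:Z) = carrier (word eta (x + 1) n) k.
Proof.
move=> /seat_exists ex rx; have : is_seat eta (seat eta).
  exact: xgetPex.
move: (seat eta) => W HW; elim: n k => [|n IH] k k_gt0.
  by rewrite addr0 (HW k k_gt0).1.
have [_ /(_ (x + n.+1%:Z))] := HW k k_gt0; rewrite arrow_step.
rewrite (_ : x + n.+1%:Z - 1 = x + n%:Z); last by lia.
rewrite word_rcons carrier_rcons (_ : x + 1 + n%:Z = x + n.+1%:Z); last by lia.
(* Index 0 is unconstrained in [is_seat], but [step] at [k] reads only the indices from 1 to [k]. *)
have -> : step (fun j => W j (x + n%:Z)) (eta (x + n.+1%:Z)) k =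
    step (carrier (word eta (x + 1) n)) (eta (x + n.+1%:Z)) k.
  by apply: step_ext => [j|]; [rewrite mem_iota => /andP[? _]|]; rewrite IH.
by case: (W k _); case: (step _ _ _).
Qed.

(** * Enumeration of the records *)

Definition records_above (eta : int -> bool) : Prop :=
  forall x, exists2 y, x <= y & is_record eta y.

Lemma next_record eta x : records_above eta -> exists y : int,
  [/\ x < y, is_record eta y & forall z, x < z < y -> ~ is_record eta z].
Proof.
move=> /(_ (x + 1))[y xy ry].
have ex : exists n : nat, `[< is_record eta (x + 1 + n%:Z) >].
  by exists (absz (y - (x + 1))%R); apply/asboolP; rewrite (_ : _ + _ = y) //; lia.
case: (ex_minnP ex) => n /asboolP rn nmin; exists (x + 1 + n%:Z); split=> //.
  by lia.
move=> z zx rz; have := nmin (absz (z - (x + 1))%R).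
by rewrite (_ : x + 1 + _ = z); [move=> /(_ (asboolT rz)); lia|lia].
Qed.

Lemma previous_record eta x : records_below eta -> exists y : int,
  [/\ y < x, is_record eta y & forall z, y < z < x -> ~ is_record eta z].
Proof.
move=> /(last_record (x - 1))[n [rn nn]]; exists (x - 1 - n%:Z); split=> //.
  by lia.
move=> z zx; have := nn (absz (x - 1 - z)%R).
by rewrite (_ : x - 1 - _%:Z = z); [apply; lia|lia].
Qed.

Lemma enum_exists eta : records_below eta -> records_above eta ->
  exists s, is_record_enum eta s.
Proof.
move=> below above.
have [nxt nxtP] := choice (fun x => next_record x above).
have [prv prvP] := choice (fun x => previous_record x below).
have [s0 [s0_le s0_rec s0_last]] : exists r : int,
    [/\ r <= 0, is_record eta r & forall z, r < z <= 0 -> ~ is_record eta z].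
  have [n [rn nn]] := last_record 0 below; exists (0 - n%:Z); split=> //.
  move=> z zx; have := nn (absz z).
  by rewrite (_ : 0 - _%:Z = z); [apply; lia|lia].
pose s (i : int) := match i with
  | Posz n => iter n nxt s0 | Negz n => iter n.+1 prv s0 end.
have sP i : [/\ s i < s (i + 1), is_record eta (s i) &
    forall z, s i < z < s (i + 1) -> ~ is_record eta z].
  case: i => n.
    rewrite -PoszD addn1 /=; have [h1 h2 h3] := nxtP (iter n nxt s0).
    by split=> //; case: (n) => [//|m] /=; have [] := nxtP (iter m nxt s0).
  have -> : s (Negz n + 1) = iter n prv s0.
    by rewrite NegzE; case: n => [//|n]; rewrite (_ : _ + 1 = Negz n) //; lia.
  by rewrite /=; have [h1 h2 h3] := prvP (iter n prv s0).
have s_lt i n : s i + n%:Z <= s (i + n%:Z).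
  elim: n => [|n IH]; first by rewrite !addr0.
  have [h _ _] := sP (i + n%:Z); by rewrite (_ : i + n.+1%:Z = i + n%:Z + 1); lia.
exists (fun i => (s i)%:E); split => //.
- move=> x; split=> [rx|[i [<-]]]; last by have [] := sP i.
  (* Consecutive values of [s] differ by at least 1, so [s i0 <= x]; the first later index whose
     value exceeds [x] then brackets [x] between consecutive records. *)
  pose i0 := - (absz (x - s0))%:Z.
  have si0 : s i0 <= x.
    have := s_lt i0 (absz (x - s0)); rewrite /i0 addNr /= -/i0; lia.
  have ex : exists n : nat, x < s (i0 + n%:Z).
    by exists (absz (x - s i0)%R).+1; apply: lt_le_trans (s_lt _ _); lia.
  case: (ex_minnP ex) => -[|n]; first by rewrite addr0; lia.
  move=> xn nmin; exists (i0 + n%:Z); congr (_%:E).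
  have xs : s (i0 + n%:Z) <= x.
    by rewrite leNgt; apply/negP => /nmin; rewrite ltnn.
  apply/eqP; rewrite eq_le xs leNgt; apply/negP => lt.
  have [_ _ /(_ x)] := sP (i0 + n%:Z); apply=> //.
  by rewrite lt /= (_ : i0 + n%:Z + 1 = i0 + n.+1%:Z) //; lia.
- move=> i j ij; right; rewrite lte_fin.
  have := s_lt i (absz (j - i)%R); rewrite (_ : i + _ = j); lia.
- rewrite lte_fin ltNge; apply/negP => s1.
  have [lt r1 _] := sP 0; have [_ {}r1 _] := sP 1.
  by apply: (s0_last (s 1)) => //; rewrite s1 andbT; move: lt; rewrite add0r.
Qed.

Lemma s_inf_enum eta : records_below eta -> records_above eta ->
  is_record_enum eta (s_inf eta).
Proof. by move=> ? ?; apply: xgetPex; exact: enum_exists. Qed.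

(** The default of [s_inf] is infinite everywhere, so a single finite value shows that an
    enumeration exists. *)
Lemma fin_num_s_inf_enum eta i : s_inf eta i \is a fin_num ->
  is_record_enum eta (s_inf eta).
Proof. by rewrite /s_inf; case: xgetP. Qed.

Section record_enum.
Variables (eta : int -> bool) (s : int -> \bar int).
Hypothesis enum_s : is_record_enum eta s.

(** The value [-oo] is impossible, as the value before it would be smaller still, and [+oo] cannot
    precede a finite value. *)
Lemma enum_succ i : s (i + 1) \is a fin_num ->
  s i \is a fin_num /\ fine (s i) < fine (s (i + 1)).
Proof.
have [_ mono _ _] := enum_s.
have := mono i (i + 1); have := mono (i - 1) i.
move=> /(_ ltac:(lia)) h1 /(_ ltac:(lia)).
case: (s i) h1 => [a _||]; case: (s (i + 1)) => [b||] //=; try by case.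
- by move=> _ [].
- by case=> //; case: (s (i - 1)).
Qed.

Lemma enum_first : exists r : int, [/\ s 0 = r%:E, is_record eta r, r <= 0 &
  forall x, r < x <= 0 -> ~ is_record eta x].
Proof.
have [rec mono s0 s1] := enum_s.
have := mono (-1) 0 isT; case s0E : (s 0) s0 => [r||] // r0; last first.
  by case=> //; case: (s (-1)).
move=> _; exists r; split=> //; first by apply/rec; exists 0.
move=> x /andP[rx x0] /rec[i si].
case: (ltgtP i 0) => [i0|i0|i0]; last first.
- by move: si rx; rewrite i0 s0E => -[->]; rewrite ltxx.
- have : (0%:E < s i)%E.
    have [<-//|] := eqVneq 1 i => i1.
    have := mono 1 i; case; [lia|by rewrite si|exact: lt_trans].
  by rewrite si lte_fin; lia.
- by have := mono i 0 i0; rewrite s0E si => -[//|]; rewrite lte_fin; lia.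
Qed.

Lemma enum_second r r' : s 0 = r%:E -> s 1 = r'%:E ->
  [/\ is_record eta r', r < r' & forall x, r < x < r' -> ~ is_record eta x].
Proof.
have [rec mono _ s1] := enum_s; move=> s0E s1E.
have [r1 [[<-] _ r10 r1P]] : exists r1, [/\ r1%:E = r%:E, is_record eta r1, r1 <= 0
    & forall x, r1 < x <= 0 -> ~ is_record eta x].
  by have [r1 [h ? ? ?]] := enum_first; exists r1; split; rewrite // -s0E h.
split; first by apply/rec; exists 1.
  by move: s1; rewrite s1E lte_fin; lia.
move=> x /andP[rx xr'] /rec[i si].
have [i0|i0] := leP i 0.
  have : (x <= 0); last by move=> x0; apply: (r1P x); rewrite ?rx //; apply/rec; exists i.
  move: i0; rewrite le_eqVlt => /predU1P[i0|i0].
    by have [_ _ + _] := enum_s; rewrite -i0 si lee_fin.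
  have := mono i 0 i0; rewrite s0E si => -[//|]; rewrite lte_fin.
  have [_ _ + _] := enum_s; rewrite s0E lee_fin; lia.
have [i1|i1] := eqVneq i 1.
  by move: si; rewrite i1 s1E => -[xE]; rewrite xE ltxx in xr'.
have := mono 1 i; case; [lia|by rewrite si|].
by rewrite s1E si lte_fin; lia.
Qed.

Lemma enum_fin : (forall i, s i \is a fin_num) ->
  records_below eta /\ records_above eta.
Proof.
move=> sfin; have [rec _ _ _] := enum_s.
have rs i : is_record eta (fine (s i)) by apply/rec; exists i; rewrite fineK.
have s_lt i n : fine (s i) + n%:Z <= fine (s (i + n%:Z)).
  elim: n => [|n IH]; first by rewrite !addr0.
  have [_] := enum_succ (sfin (i + n%:Z + 1)).
  by rewrite (_ : i + n%:Z + 1 = i + n.+1%:Z); lia.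
pose a := fine (s 0); split=> x.
  pose n := absz (x - a)%R; exists (fine (s (- n%:Z))) => //.
  by have := s_lt (- n%:Z) n; rewrite addNr -/a /n; lia.
pose n := absz (x - a)%R; exists (fine (s (0 + n%:Z))) => //.
apply: le_trans (s_lt 0 n); rewrite -/a /n; lia.
Qed.

End record_enum.

(** Conversely, negative indices have values below [s_inf eta 0]; and were the value at [n] finite
    and the next one infinite, no index would be left for the records beyond the former. *)
Lemma fin_num_s_inf eta : (forall i, s_inf eta i \is a fin_num) <->
  records_below eta /\ records_above eta.
Proof.
split=> [fin|[below above] i]; first exact: enum_fin (fin_num_s_inf_enum (fin 0)) fin.
have [rec mono s0 _] := s_inf_enum below above.
have [j0|j0] := ltP i 0.
  have := mono i 0 j0; have := mono (i - 1) i; move=> /(_ ltac:(lia)).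
  case: (s_inf eta i) => [//|_|]; first by case: (s_inf eta 0) s0 => [a||] //= _ [].
  by case=> //; case: (s_inf eta (i - 1)).
rewrite -(gez0_abs j0); elim: (absz i) => [|n IH].
  by have [r [-> _ _ _]] := enum_first (s_inf_enum below above).
have := mono n n.+1%:Z; move=> /(_ ltac:(lia)).
case sE : (s_inf eta n.+1%:Z) => [//||]; last by case=> //; case: (s_inf eta n) IH.
move: IH; case snE : (s_inf eta n) => [a||] // _ _.
have [y ay] := above (a + 1).
move=> /rec[j sj].
have [jn|jn] := leP j n.
  have : (s_inf eta j <= s_inf eta n)%E.
    move: jn; rewrite le_eqVlt => /predU1P[-> //|/mono[|/ltW//]].
    by rewrite snE.
  by rewrite sj snE lee_fin; lia.
have [jn1|jn1] := eqVneq j n.+1%:Z; first by rewrite jn1 sE in sj.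
have := mono n.+1%:Z j; case; [lia|by rewrite sj|by rewrite sE sj].
Qed.

(** * Soliton numbers of an excursion *)

Lemma antidifference (g : int -> int) :
  exists f : int -> int, f 0 = 0 /\ forall x, f x - f (x - 1) = g x.
Proof.
exists (fun x => match x with
  | Posz n => \sum_(0 <= i < n) g i.+1%:Z
  | Negz n => - \sum_(0 <= i < n.+1) g (- i%:Z) end).
split=> [|[[|n]|n]]; first by rewrite /= big_geq.
- rewrite (_ : 0%:Z - 1 = Negz 0) //= big_geq // big_nat1 oppr0.
  by rewrite sub0r opprK.
- rewrite (_ : n.+1%:Z - 1 = n); last by lia.
  by rewrite big_nat_recr //= addrAC subrr add0r.
- rewrite (_ : Negz n - 1 = Negz n.+1); last by lia.
  rewrite /= [X in _ - - X]big_nat_recr //= NegzE.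
  by rewrite opprK addrA addNr add0r.
Qed.

(** * First hitting times of a clock with steps 0 and 1 *)

Section counting_clock.
Variables (X g : int -> int) (N : nat).
Hypothesis X0 : X 0 = 0.
Hypothesis X_incr : forall x, 0 <= X x - X (x - 1) <= 1.
Hypothesis X_neg : forall x, x <= 0 -> X x - X (x - 1) = 1.
Hypothesis X_N : X N - X (N%:Z - 1) = 1.

Let X_le x n : X x <= X (x + n%:Z).
Proof.
elim: n => [|n IH]; first by rewrite addr0.
have := X_incr (x + n.+1%:Z).
by rewrite (_ : x + n.+1%:Z - 1 = x + n%:Z); lia.
Qed.

Let X_mono x y : x <= y -> X x <= X y.
Proof.
move=> xy; have := X_le x (absz (y - x)%R).
by rewrite (_ : x + _ = y) //; lia.
Qed.

Let first (i : int) : int :=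
  xget 0 [set y | X y = i /\ forall z, X z = i -> y <= z].

Let first_eq y i : X y = i -> X (y - 1) = i - 1 -> first i = y.
Proof.
move=> Xy Xy1; have ymin z : X z = i -> y <= z.
  move=> Xz; rewrite leNgt; apply/negP => zy.
  have : X z <= X (y - 1) by apply: X_mono; lia.
  by lia.
apply: xget_unique => // z [Xz zmin]; apply/eqP; rewrite eq_le zmin // andTb.
exact: ymin.
Qed.

Let X1 : X (0 - 1) = 0 - 1.
Proof. by have : X 0 - X (0 - 1) = 1 := X_neg (lexx 0); rewrite X0; lia. Qed.

Let X_hit (n : nat) (i : int) : 0 <= i <= X n ->
  exists m : nat, X m = i /\ X (m%:Z - 1) = i - 1.
Proof.
elim: n => [|n IH].
  by rewrite X0 => i0; have -> : i = 0; [lia|exists 0%N].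
have := X_incr n.+1%:Z; rewrite (_ : n.+1%:Z - 1 = n%:Z); last by lia.
move=> Xn i0; have [iX|Xi] := leP i (X n); first by apply: IH; rewrite iX andbT; case/andP: i0.
exists n.+1; rewrite (_ : n.+1%:Z - 1 = n%:Z); last by lia.
by split; lia.
Qed.

(** The intervals between successive first hitting times tile the sites [1, ..., N]. It is applied
    to [xi], for which [first] is [s_]. *)
Lemma sum_between_hits :
  \sum_(i \in `[0, X N[) \sum_(y \in `](first i), (first (i + 1))]) g y =
  \sum_(0 <= j < N) g j.+1%:Z.
Proof.
have XN_ge0 : 0 <= X N by have := X_le 0 N; rewrite X0 add0r.
set K := absz (X N).
have hit (i : nat) : exists m : nat,
    (i <= K)%N -> X m = i%:Z /\ X (m%:Z - 1) = i%:Z - 1.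
  have [iK|Ki] := leqP i K; last by exists 0%N; lia.
  by have [m Hm] := @X_hit N i%:Z ltac:(lia); exists m.
have [t tP] := choice hit.
have firstE i : (i <= K)%N -> first i = t i.
  by move=> /tP[h1 h2]; exact: first_eq.
have t_mono i : (i < K)%N -> (t i <= t i.+1)%N.
  move=> iK; have [h1 _] := tP i (ltnW iK); have [h2 _] := tP i.+1 iK.
  rewrite leqNgt; apply/negP => lt; have := @X_mono (t i.+1) (t i) ltac:(lia).
  by lia.
have t0 : t 0%N = 0%N.
  by have := firstE 0%N isT; rewrite (first_eq X0 X1); lia.
(* The clock advances at site [N], so [N] is its first visit to [X N]; likewise for site 0 above. *)
have tK : t K = N.
  have := firstE K (leqnn K); rewrite (@first_eq N K%:Z) //; try by rewrite /K; lia.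

rewrite (_ : X N = 0 + K%:Z); last by rewrite /K; lia.
rewrite fsbig_itvco -[in RHS]tK.
suff main m : (m <= K)%N ->
    \sum_(0 <= i < m) \sum_(y \in `](first (0 + i%:Z)), (first (0 + i%:Z + 1))]) g y =
    \sum_(0 <= j < t m) g j.+1%:Z by exact: main.
elim: m => [|n IH] nK; first by rewrite t0 !big_geq.
rewrite big_nat_recr //= IH; last by exact: ltnW.
rewrite [RHS](@big_cat_nat _ _ _ (t n)) ?t_mono //=; congr (_ + _).
rewrite add0r (_ : n%:Z + 1 = n.+1%:Z); last by lia.
rewrite !firstE ?(ltnW nK) // itv_int_oc.
have tn := t_mono n nK.
rewrite (_ : (t n.+1)%:Z + 1 = (t n)%:Z + 1 + (t n.+1 - t n)%N%:Z); last by lia.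
rewrite fsbig_itvco -[in RHS](add0n (t n)) big_addn; apply: eq_bigr => i _.
by congr g; lia.
Qed.

End counting_clock.

Definition body (e : excursion) : seq bool := behead e.

Lemma excursion_body e : letters e = false :: body e /\ dyck 0 (body e).
Proof.
have : is_excursion e by case: e.
by move=> /excursionP[w ew dw]; rewrite /body ew.
Qed.

Lemma excursionE e : letters e = false :: body e.
Proof. by have [] := excursion_body e. Qed.

Lemma dyck_body e : dyck 0 (body e).
Proof. by have [] := excursion_body e. Qed.

Lemma size_excursion (e : excursion) : size e = (size (body e)).+1.
Proof. by rewrite excursionE. Qed.

Section iota.
Variable e : excursion.
Let eta := iota_exc e.
Let w := body e.

Lemma iota_nonpos x : x <= 0 -> eta x = false.
Proof.
case: x => [n|//] n0; have -> : n = 0%N by lia.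
by rewrite /eta /= excursionE.
Qed.

Lemma iota_large x : (size e)%:Z <= x -> eta x = false.
Proof. by case: x => [n|//] n0; rewrite /eta /= nth_default. Qed.

Lemma word_iota : word eta (0 + 1) (size w) = w.
Proof.
rewrite -[RHS](mkseq_nth false); apply: eq_mkseq => i.
by rewrite /eta add0r -PoszD /= excursionE.
Qed.

Lemma iota_record_nonpos x : x <= 0 -> is_record eta x.
Proof.
move=> x0; apply/recordE => a z /andP[_ zx].
have H n : z + n%:Z <= x + 1 -> height (word eta z n) = - n%:Z.
  elim: n => [|n IH] zn; first by rewrite height_nil.
  rewrite word_rcons -cats1 height_cat IH ?height_cons ?height_nil; last by lia.
  by rewrite iota_nonpos /=; lia.
by rewrite H; lia.
Qed.

Lemma iota_record_size : is_record eta (size e)%:Z.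
Proof.
apply/recordE => a; rewrite size_excursion -/w (_ : _.+1%:Z = 0 + 1 + (size w)%:Z); last by lia.
apply: record_after; first exact: (recordE _ _).1 (iota_record_nonpos (lexx 0)) a.
- by rewrite word_iota dyck_body.
- by rewrite iota_large // size_excursion -/w; lia.
Qed.

Lemma iota_record_large x : (size e)%:Z <= x -> is_record eta x.
Proof.
move=> ex; have -> : x = (size e)%:Z + (absz (x - (size e)%:Z)%R)%:Z by lia.
elim: (absz _) => [|n IH]; first by rewrite addr0; exact: iota_record_size.
apply/recordE => a; have := (recordE _ _).1 IH a.
move=> /(@record_after _ _ _ 0) H.
rewrite (_ : _ + _ = (size e)%:Z + n%:Z + 1 + 0%:Z); last by lia.
by apply: H => //; apply: iota_large; lia.
Qed.

Lemma iota_records_below : records_below eta.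
Proof.
move=> x; exists (- (absz x)%:Z); first by lia.
by apply: iota_record_nonpos; lia.
Qed.

Lemma iota_records_above : records_above eta.
Proof.
move=> x; exists ((size e)%:Z + (absz x)%:Z); first by lia.
by apply: iota_record_large; lia.
Qed.

Lemma s_inf_iota : s_inf eta 0 = 0%:E.
Proof.
have [r [-> _ r0 rmax]] :=
  enum_first (s_inf_enum iota_records_below iota_records_above).
congr (_%:E); apply/eqP; rewrite eq_le r0 leNgt; apply/negP => rneg.
by apply: (rmax 0); [rewrite rneg lexx|exact: iota_record_nonpos].
Qed.

Lemma seat_iota k n : (0 < k)%N -> (n <= size w)%N ->
  seat eta k n%:Z = carrier (take n w) k.
Proof.
move=> k0 nw; rewrite -[n%:Z]add0r.
rewrite seatE //; [|exact: iota_records_below|exact: iota_record_nonpos].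
by rewrite -(take_word _ _ nw) word_iota.
Qed.

Lemma seat_record k x : (0 < k)%N -> is_record eta x -> seat eta k x = false.
Proof.
by move=> k0 rx; rewrite -[x]addr0 (seatE 0 iota_records_below).
Qed.

(** At most one of the seats 1, ..., [k] changes at a site; none does exactly when a ball finds them
    all full or an empty site finds them all empty. *)
Lemma sum_arrows (W : nat -> int -> bool) k (x : int) :
  1 - \sum_(1 <= j < k.+1) (arrow_up eta W j x + arrow_down eta W j x) =
  (if eta x then all (fun j => W j (x - 1)) (iota 1 k)
   else ~~ has (fun j => W j (x - 1)) (iota 1 k) : bool)%:Z.
Proof.
elim: k => [|k IH]; first by rewrite big_geq // subr0; case: ifP.
have -> : iota 1 k.+1 = rcons (iota 1 k) k.+1.
  by rewrite -[in LHS](addn1 k) iotaD -cats1 add1n.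
rewrite all_rcons has_rcons big_nat_recr //= opprD addrA IH /arrow_up /arrow_down.
rewrite (prod_all (fun j => W j (x - 1))) (prod_has (fun j => W j (x - 1))) /=.
by case: (eta x); case: (all _ _); case: (has _ _); case: (W _ _).
Qed.

Lemma xi_spec k : xi k eta 0 = 0 /\ forall x, xi k eta x - xi k eta (x - 1) =
  (if eta x then all (fun j => seat eta j (x - 1)) (iota 1 k)
   else ~~ has (fun j => seat eta j (x - 1)) (iota 1 k) : bool)%:Z.
Proof.
pose P := [set f : int -> int | f (fine (s_inf eta 0)) = 0 /\
  forall x, f x - f (x - 1) =
    1 - \sum_(1 <= j < k.+1) (eta_up eta j x + eta_down eta j x)].
have : P (xi k eta) by apply: xgetPex; rewrite /P s_inf_iota; exact: antidifference.
by rewrite /P s_inf_iota => -[h1 h2]; split=> // x; rewrite h2 -sum_arrows.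
Qed.

Lemma xi_record k x : is_record eta x ->
    (forall j, (0 < j)%N -> seat eta j (x - 1) = false) ->
  xi k eta x - xi k eta (x - 1) = 1.
Proof.
move=> rx emp; have [_ ->] := xi_spec k; rewrite (record_letter rx).
rewrite (_ : has _ _ = false) //; apply/hasPn => j.
by rewrite mem_iota => /andP[j0 _]; rewrite emp.
Qed.

(** By [sum_between_hits] the sum over [i] becomes one over the sites [1, ..., size e]: up arrows of
    seat [k] minus those of seat [k.+1], which [ups_solitons] evaluates. *)
Lemma zeta_excE k : (0 < k)%N -> zeta_exc k e = (solitons k w)%:Z.
Proof.
move=> k0; rewrite /zeta_exc /zeta.
have [xi0 xiP] := xi_spec k.
rewrite (@sum_between_hits (xi k eta)
  (fun y => eta_up eta k y - eta_up eta k.+1 y) (size e)) //; last 3 first.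
- by move=> x; rewrite xiP; case: ifP => _; [case: (all _ _)|case: (has _ _)].
- move=> x x0; apply: xi_record; first exact: iota_record_nonpos.
  by move=> j j0; apply: seat_record => //; apply: iota_record_nonpos; lia.
- apply: xi_record; first exact: iota_record_size.
  move=> j j0; rewrite size_excursion -/w (_ : _ - 1 = (size w)%:Z); last by lia.
  by rewrite seat_iota // take_size carrier_dyck // dyck_body.
have upsE j : (0 < j)%N ->
    \sum_(0 <= n < size e) eta_up eta j n.+1%:Z = (ups j [::] w)%:Z.
  move=> j0; rewrite size_excursion big_nat_recr //= -/w.
  (* The last site [size e] lies just beyond the excursion; it is empty, so it carries no up
     arrow. *)
  rewrite [X in _ + X](_ : _ = 0) ?addr0; last first.
    rewrite /eta_up /arrow_up iota_large ?mul0r // size_excursion -/w; lia.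
  have H u v : w = u ++ v -> \sum_(size u <= n < size w) eta_up eta j n.+1%:Z =
      (ups j u v)%:Z.
    elim: v u => [|b v IH] u wE; first by rewrite wE cats0 big_geq.
    have wE' : w = rcons u b ++ v by rewrite cat_rcons.
    have uw : (size u < size w)%N by rewrite wE size_cat /=; lia.
    have IH' := IH _ wE'; rewrite size_rcons in IH'; rewrite big_ltn // IH' /=.
    rewrite PoszD; congr (_ + _).
    rewrite /eta_up /arrow_up (_ : _ - 1 = (size u)%:Z); last by lia.
    rewrite (prod_all (fun i => seat eta i (size u)%:Z)) seat_iota ?(ltnW uw) //.
    have -> : take (size u) w = u by rewrite wE take_size_cat.
    have -> : eta (size u).+1%:Z = b.
      by rewrite /eta /= excursionE -/w wE /= nth_cat ltnn subnn.
    rewrite (@eq_in_all _ _ (carrier u)); last first.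
      move=> i; rewrite mem_iota => /andP[i0 _].
      by rewrite seat_iota ?(ltnW uw) // wE take_size_cat.
    by case: b {wE wE' IH IH'}; case: (carrier u j); case: (all _ _).
  exact: (H [::]).
rewrite big_split /= sumrN !upsE // (ups_solitons k0 (dyck_body e)) -/w; lia.
Qed.

End iota.

(** * Weights and means *)

(** For an infinite factor, either all terms vanish or one positive term makes both sides
    infinite. *)
Lemma esumZl (R : realType) (T : choiceType) (I : set T) (a : T -> \bar R) c :
  (0 <= c)%E -> (forall i, (0 <= a i)%E) ->
  (\esum_(i in I) (c * a i) = c * \esum_(i in I) a i)%E.
Proof.
move=> c0 a0; case: c c0 => [r||] // r0.
  rewrite /esum -ereal_supZl; last 2 first.
  - by apply/set0P; exists 0%E; exists set0; rewrite ?fsbig_set0 //; exact: fsets_set0.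
  - by rewrite -lee_fin.
  congr ereal_sup; rewrite image_comp; apply: eq_imagel => A _.
  by rewrite /= ge0_mule_fsumr.
have [all0|] := pselect (forall i, I i -> a i = 0%E).
  rewrite (esum1 all0) mule0; apply: esum1 => i Ii.
  by rewrite all0 // mule0.
move=> /existsNP[j /not_implyP[Ij aj]].
have ajp : (0 < a j)%E by rewrite lt_def a0 // andbT; exact/eqP.
have le_j (b : T -> \bar R) : (forall i, I i -> (0 <= b i)%E) ->
    (b j <= \esum_(i in I) b i)%E.
  move=> b0; apply: esum_ge; exists [set j].
    by split=> [|i -> //]; exact: finite_set1.
  by rewrite fsbig_set1.
rewrite gt0_mulye; last by apply: lt_le_trans ajp (le_j _ _) => i Ii.
have := le_j (fun i => +oo * a i)%E (fun i _ => mule_ge0 (leey 0) (a0 i)).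
by rewrite gt0_mulye // leye_eq => /eqP.
Qed.

Section weights.
Variable R : realType.
Implicit Types (q : nat -> R) (w : seq bool).

(** The weight of the gaps around the letters of the [k]-th skeleton, geometric of parameter [q k];
    there is one gap more than letters. *)
Definition soliton_factor q w k : R :=
  q k ^+ solitons k w * (1 - q k) ^+ (size (iter k (skeleton false) w)).+1.

Definition word_weight q w : R :=
  limn (fun n => \prod_(1 <= k < n) soliton_factor q w k).

Definition subunit q := forall k, (0 < k)%N -> 0 <= q k < 1.

Lemma dyck_iter k w : dyck 0 w -> dyck 0 (iter k (skeleton false) w).
Proof. by move=> dw; elim: k => //= k; exact: dyck_skeleton0. Qed.

Lemma solitons_iter k l w : (0 < l)%N ->
  solitons (k + l) w = solitons l (iter k (skeleton false) w).
Proof.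
elim: k w => [//|k IH] w l0.
by rewrite addSn solitonsS ?addn_gt0 ?l0 ?orbT // IH // iterSr.
Qed.

(** The solitons of the [k]-th skeleton are those of size above [k], shortened by [k], so the sum is
    half its length by [sum_solitons]. *)
Lemma soliton_exponent k (e : excursion) : (0 < k)%N ->
  1 + 2 * (\sum_(l \in [set l : nat | (0 < l)%N]) l%:Z * zeta_exc (k + l) e)
  = (size (iter k (skeleton false) (body e))).+1%:Z.
Proof.
move=> k0; set v := iter k _ _.
have dv : dyck 0 v by exact/dyck_iter/dyck_body.
have zE l : (0 < l)%N -> zeta_exc (k + l) e = (solitons l v)%:Z.
  by move=> l0; rewrite zeta_excE ?addn_gt0 ?k0 // solitons_iter.
rewrite -(@fsbig_widen _ _ _ _ ([set l : nat | (0 < l < (size v).+1)%N])); last 2 first.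
- by move=> l /= /andP[].
- move=> l [/= l0 nl]; rewrite zE // solitons_gt_size ?mulr0 //; lia.
rewrite (reindex_fsbig S `I_(size v)); last first.
  split=> [i /=|i j _ _ [//]|[|l] //= h]; first by lia.
  by exists l => //=; lia.
rewrite -fsbig_ord -(big_mkord xpredT (fun i => i.+1%:Z * zeta_exc (k + i.+1) e)).
have [_ sz] := sum_solitons dv (leqnn _); rewrite big_add1 /= in sz.
under eq_bigr do rewrite zE // -PoszM.
rewrite -(big_morph _ PoszD (erefl 0%:Z)); lia.
Qed.

Lemma exc_weightE q e : exc_weight q e = word_weight q (body e).
Proof.
rewrite /exc_weight /word_weight; congr (limn _); apply/funext => n.
apply: eq_big_nat => k /andP[k0 _].
by rewrite soliton_exponent // zeta_excE.
Qed.

Lemma soliton_factor_itv q w k : subunit q -> (0 < k)%N ->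
  0 <= soliton_factor q w k <= 1.
Proof.
move=> q1 /q1/andP[q0 ql].
rewrite mulr_ge0 ?exprn_ge0 ?subr_ge0 ?(ltW ql) //=.
by rewrite mulr_ile1 ?exprn_ge0 ?exprn_ile1 ?subr_ge0 ?(ltW ql) // lerBlDr lerDl.
Qed.

(** All factors lie between 0 and 1, so the partial products decrease and stay nonnegative. *)
Lemma word_weight_cvg q w : subunit q ->
  cvgn (fun n => \prod_(1 <= k < n) soliton_factor q w k).
Proof.
move=> q1; apply: nonincreasing_is_cvgn.
  apply/nonincreasing_seqP => -[|n]; first by rewrite !big_geq.
  rewrite big_nat_recr //= ler_piMr //; last first.
    by have /andP[] := soliton_factor_itv w q1 (ltn0Sn n).
  rewrite big_nat_cond prodr_ge0 // => k /andP[/andP[k0 _] _].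
  by have /andP[] := soliton_factor_itv w q1 k0.
exists 0 => _ [n _ <-]; rewrite big_nat_cond prodr_ge0 // => k /andP[/andP[k0 _] _].
by have /andP[] := soliton_factor_itv w q1 k0.
Qed.

Lemma word_weight_ge0 q w : subunit q -> 0 <= word_weight q w.
Proof.
move=> q1; apply: limr_ge; first exact: word_weight_cvg.
near=> n; rewrite big_nat_cond prodr_ge0 // => k /andP[/andP[k0 _] _].
by have /andP[] := soliton_factor_itv w q1 k0.
Unshelve. all: by end_near. Qed.

Lemma subunitS q : subunit q -> subunit (q \o S).
Proof. by move=> q1 k _; exact: q1. Qed.

Lemma prod_geometric (a b : R) (ms : seq nat) :
  \prod_(m <- ms) (a ^+ m * b) = a ^+ sumn ms * b ^+ size ms.
Proof.
elim: ms => [|m ms IH]; first by rewrite big_nil mulr1.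
by rewrite big_cons IH /= exprD exprS mulrACA.
Qed.

(** The factor [k = 1] is the geometric weight of the gaps; the remaining ones are the factors of
    the skeleton for the shifted parameters. *)
Lemma word_weight_skeleton q w : subunit q -> dyck 0 w ->
  word_weight q w =
  (\prod_(m <- gaps false 0 w) (q 1%N ^+ m * (1 - q 1%N))) *
    word_weight (q \o S) (skeleton false w).
Proof.
move=> q1 dw; rewrite prod_geometric size_gaps -[_ * _ in RHS]/(soliton_factor q w 1 * _).
(* Two shifts of the index ensure that the factor [k = 1] is present in every partial product. *)
apply/cvg_lim => //; rewrite -cvg_shiftS -cvg_shiftS.
have /cvg_ex[l vl] := @word_weight_cvg (q \o S) (skeleton false w) (subunitS q1).
have -> : word_weight (q \o S) (skeleton false w) = l by apply/cvg_lim.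
have -> : (fun n => \prod_(1 <= k < n.+2) soliton_factor q w k) =
   (fun n => soliton_factor q w 1 *
      \prod_(1 <= k < n.+1) soliton_factor (q \o S) (skeleton false w) k).
  apply/funext => n; rewrite big_ltn // big_add1 /=; congr (_ * _).
  apply: eq_big_nat => k /andP[k0 _].
  by rewrite /soliton_factor solitonsS // iterSr.
apply: cvgMl_tmp.
by rewrite (cvg_shiftS (fun n => \prod_(1 <= k < n) soliton_factor _ _ k)).
Qed.

Lemma word_weight_inflate q w ms : subunit q -> dyck 0 w ->
    size ms = (size w).+1 ->
  word_weight q (inflate false w ms) =
  (\prod_(m <- ms) (q 1%N ^+ m * (1 - q 1%N))) * word_weight (q \o S) w.
Proof.
move=> q1 dw sz; rewrite word_weight_skeleton //; last exact: dyck_inflate.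
by rewrite skeleton_inflate // gaps_inflate.
Qed.

End weights.

Section word_means.
Variable R : realType.
Implicit Types (q : nat -> R) (w : seq bool).

Definition dyck_words : set (seq bool) := [set w | dyck 0 w].
Definition lists (n : nat) : set (seq nat) := [set ms | size ms = n].

Lemma set_bij_body : set_bij [set: excursion] dyck_words body.
Proof.
split=> [e _|e1 e2 _ _ h|w dw]; first exact: dyck_body.
  by apply: val_inj; rewrite /= !excursionE h.
have we : is_excursion (false :: w) by apply/excursionP; exists w.
by exists (Excursion we).
Qed.

(** The inverse takes a word to its skeleton and its gaps. The gap list is arbitrary apart from its
    length, whence the independence of the gaps. *)
Lemma set_bij_inflate :
  set_bij (dyck_words `*`` (fun w => lists (size w).+1)) dyck_words
    (fun p => inflate false p.1 p.2).
Proof.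
split.
- by move=> [w ms] [/= dw sz]; exact: dyck_inflate.
- move=> [w1 ms1] [w2 ms2] /set_mem [/= d1 s1] /set_mem [/= d2 s2] h; congr pair.
    by rewrite -(skeleton_inflate false s1) h skeleton_inflate.
  by rewrite -(gaps_inflate false s1) h gaps_inflate.
- move=> w dw; exists (skeleton false w, gaps false 0 w) => /=; last exact: inflate_skeleton.
  by split; [exact: dyck_skeleton0|rewrite /lists /= size_gaps].
Qed.

Lemma esum_inflate (a : seq bool -> \bar R) : (forall w, (0 <= a w)%E) ->
  (\esum_(w in dyck_words) a w =
   \esum_(w in dyck_words) \esum_(ms in lists (size w).+1) a (inflate false w ms))%E.
Proof.
move=> a0; rewrite (esum_esum (fun w ms _ _ => a0 (inflate false w ms))).
exact: reindex_esum set_bij_inflate.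
Qed.

Lemma esum_swap (T U : choiceType) (I : set T) (J : set U) (a : T -> U -> \bar R) :
  (forall i j, (0 <= a i j)%E) ->
  (\esum_(i in I) \esum_(j in J) a i j = \esum_(j in J) \esum_(i in I) a i j)%E.
Proof.
move=> a0; rewrite !esum_esum //.
rewrite (reindex_esum (J `*` I) _ (fun p => (p.2, p.1))) //.
split=> [[j i] [? ?] //|[j i] [j' i'] _ _ [-> ->] //|[i j] [/= Ii Jj]].
by exists (j, i).
Qed.

Lemma esum_cons n (a : seq nat -> \bar R) : (forall ms, (0 <= a ms)%E) ->
  (\esum_(ms in lists n.+1) a ms =
   \esum_(m in [set: nat]) \esum_(ms in lists n) a (m :: ms))%E.
Proof.
move=> a0; rewrite (esum_esum (fun m ms _ _ => a0 (m :: ms))).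
apply: (reindex_esum _ _ (fun p : nat * seq nat => p.1 :: p.2)).
split=> [[m ms] [_ /= sz]|[m ms] [m' ms'] _ _ /= [-> ->] //|[|m ms] //= [sz]].
  by rewrite /lists /= sz.
by exists (m, ms).
Qed.

Section geometric_gaps.
Variable a : R.
Hypothesis a01 : 0 <= a < 1.

Definition geometric_weight (m : nat) : R := a ^+ m * (1 - a).
Definition gaps_weight (ms : seq nat) : R := \prod_(m <- ms) geometric_weight m.
(** Left as an extended real: it enters the final induction as a coefficient common to all the means
    compared. *)
Definition mean_gap : \bar R :=
  (\esum_(m in [set: nat]) (geometric_weight m * m%:R)%:E)%E.

Let g_ge0 m : 0 <= geometric_weight m.
Proof. by case/andP: a01 => ? /ltW ?; rewrite mulr_ge0 ?exprn_ge0 ?subr_ge0. Qed.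

Let gs_ge0 ms : 0 <= gaps_weight ms.
Proof. exact: prodr_ge0. Qed.

Lemma mean_gap_ge0 : (0 <= mean_gap)%E.
Proof. by apply: esum_ge0 => m _; rewrite lee_fin mulr_ge0. Qed.

Lemma esum_geometric : (\esum_(m in [set: nat]) (geometric_weight m)%:E = 1)%E.
Proof.
case/andP: (a01) => a0 a1.
rewrite -nneseries_esumT; last by move=> m; rewrite lee_fin.
apply/cvg_lim => //.
have -> : (fun n => \sum_(0 <= i < n) (geometric_weight i)%:E)%E =
    EFin \o series (geometric (1 - a) a).
  apply/funext => n; rewrite /= /series /= sumEFin; congr (_%:E).
  by apply: eq_bigr => i _; rewrite /geometric_weight mulrC.
apply: cvg_EFin; first by apply: nearW => n.
rewrite -[1]/(fine 1%E : R) /=.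
rewrite -[X in _ --> X](@mulfV _ (1 - a)); last by rewrite subr_eq0 gt_eqF.
by apply: cvg_geometric_series; rewrite ger0_norm.
Qed.

Lemma esum_gaps_weight n : (\esum_(ms in lists n) (gaps_weight ms)%:E = 1)%E.
Proof.
elim: n => [|n IH].
  rewrite (_ : lists 0 = [set [::]]); last first.
    by apply/seteqP; split=> [ms /= /size0nil|ms /= ->].
  by rewrite esum_set1 /gaps_weight ?big_nil.
rewrite esum_cons; last by move=> ms; rewrite lee_fin.
rewrite -[RHS]esum_geometric; apply: eq_esum => m _.
under eq_esum => ms _ do
  rewrite /gaps_weight big_cons -/(gaps_weight ms) EFinM.
by rewrite esumZl ?lee_fin // [X in (_ * X)%E]IH mule1.
Qed.

(** Independence of the first gap from the others, in the form that peels off one gap at a time. *)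
Lemma esum_gaps_head n (x : nat) (h : seq nat -> nat) :
  (\esum_(ms in lists n.+1) (gaps_weight ms * (x * head 0 ms + h (behead ms))%:R)%:E =
   x%:R%:E * mean_gap + \esum_(ms in lists n) (gaps_weight ms * (h ms)%:R)%:E)%E.
Proof.
rewrite esum_cons; last by move=> ms; rewrite lee_fin mulr_ge0.
have t1_ge0 m ms : (0 <= (x%:R * (geometric_weight m * m%:R))%:E * (gaps_weight ms)%:E)%E.
  by rewrite -EFinM lee_fin mulr_ge0 // mulr_ge0 // mulr_ge0.
have t2_ge0 m ms : (0 <= (gaps_weight ms * (h ms)%:R)%:E * (geometric_weight m)%:E)%E.
  by rewrite -EFinM lee_fin mulr_ge0 // mulr_ge0.
transitivity (\esum_(m in [set: nat]) (
    \esum_(ms in lists n) ((x%:R * (geometric_weight m * m%:R))%:E * (gaps_weight ms)%:E) +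
    \esum_(ms in lists n) ((gaps_weight ms * (h ms)%:R)%:E * (geometric_weight m)%:E)))%E.
  apply: eq_esum => m _; rewrite -esumD //; apply: eq_esum => ms _.
  rewrite -!EFinM -EFinD /gaps_weight big_cons natrD natrM; congr (_%:E).
  by rewrite /=; ring.
rewrite esumD; [|by move=> *; exact: esum_ge0..].
congr (_ + _)%E.
  rewrite -esumZl // => [|m]; last by rewrite lee_fin mulr_ge0.
  apply: eq_esum => m _.
  rewrite esumZl; last 2 first.
  - by rewrite lee_fin mulr_ge0 // mulr_ge0.
  - by move=> ms; rewrite lee_fin.
  by rewrite [X in (_ * X)%E]esum_gaps_weight mule1 EFinM.
rewrite esum_swap //; apply: eq_esum => ms _.
rewrite esumZl; last 2 first.
- by rewrite lee_fin mulr_ge0.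
- by move=> m; rewrite lee_fin.
by rewrite [X in (_ * X)%E]esum_geometric mule1.
Qed.

(** All gaps have the same mean, and the weights [V] of the successive prefixes add up to the
    occupation. *)
Lemma esum_weighted V u w :
  (\esum_(ms in lists (size w).+1) (gaps_weight ms * (weighted V u w ms)%:R)%:E =
   (occupation V u w)%:R%:E * mean_gap)%E.
Proof.
elim: w u => [|b w IH] u /=.
  transitivity (\esum_(ms in lists 1)
      (gaps_weight ms * (V u * head 0%N ms + (fun=> 0%N) (behead ms))%:R)%:E)%E.
    by apply: eq_esum => -[//|m ms] _.
  rewrite (esum_gaps_head 0 _ (fun=> 0%N)) addn0 [X in (_ + X)%E]esum1 ?adde0 // => ms _.
  by rewrite mulr0.
transitivity (\esum_(ms in lists (size w).+2) (gaps_weight ms *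
    (V u * head 0%N ms + (fun ms => weighted V (rcons u b) w ms) (behead ms))%:R)%:E)%E.
  by apply: eq_esum => -[//|m ms] _.
rewrite (esum_gaps_head _ _ (weighted V (rcons u b) w)) [X in (_ + X)%E]IH.
by rewrite -ge0_muleDl ?lee_fin // -EFinD -natrD.
Qed.

End geometric_gaps.

(** * Means of word statistics and their transformation under skeletons *)

Definition word_mean q (F : seq bool -> nat) : \bar R :=
  (\esum_(w in dyck_words) (word_weight q w * (F w)%:R)%:E)%E.

Lemma word_mean_ge0 q F : subunit q -> (0 <= word_mean q F)%E.
Proof.
move=> q1; apply: esum_ge0 => w _.
by rewrite lee_fin mulr_ge0 // word_weight_ge0.
Qed.

Lemma word_meanD q F G : subunit q ->
  (word_mean q (fun w => F w + G w)%N = word_mean q F + word_mean q G)%E.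
Proof.
move=> q1; rewrite /word_mean -esumD.
- by apply: eq_esum => w _; rewrite natrD mulrDr EFinD.
- by move=> w _; rewrite lee_fin mulr_ge0 // word_weight_ge0.
- by move=> w _; rewrite lee_fin mulr_ge0 // word_weight_ge0.
Qed.

Lemma eq_word_mean q F G : {in dyck 0, F =1 G} ->
  word_mean q F = word_mean q G.
Proof. by move=> FG; apply: eq_esum => w dw; rewrite FG. Qed.

(** Sum over the gaps first, at fixed skeleton: their total weight is 1, and [esum_weighted]
    averages the weighted term. *)
Lemma word_mean_inflate q V (F x : seq bool -> nat) : subunit q ->
  (forall w ms, dyck 0 w -> size ms = (size w).+1 ->
    F (inflate false w ms) = (x w + (weighted V [::] w ms).*2)%N) ->
  (word_mean q F = word_mean (q \o S) x +
    2%:E * mean_gap (q 1%N) * word_mean (q \o S) (occupation V [::]))%E.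
Proof.
move=> q1 FE; have a01 := q1 1%N isT; have q1' := subunitS q1.
have W0 w := word_weight_ge0 w q1'.
have gs0 ms : 0 <= gaps_weight (q 1%N) ms.
  apply: prodr_ge0 => m _; case/andP: a01 => ? /ltW ?.
  by rewrite mulr_ge0 ?exprn_ge0 ?subr_ge0.
have c0 := mean_gap_ge0 a01.
rewrite /word_mean esum_inflate; last first.
  by move=> w; rewrite lee_fin mulr_ge0 // word_weight_ge0.
rewrite -esumZl ?mule_ge0 //; last by move=> w; rewrite lee_fin mulr_ge0.
rewrite -esumD; last 2 first.
- by move=> w _; rewrite lee_fin mulr_ge0.
- by move=> w _; rewrite !mule_ge0 // lee_fin mulr_ge0.
apply: eq_esum => w dw.
transitivity (\esum_(ms in lists (size w).+1)
  ((word_weight (q \o S) w * (x w)%:R)%:E * (gaps_weight (q 1%N) ms)%:E +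
   (word_weight (q \o S) w * 2)%:E *
     (gaps_weight (q 1%N) ms * (weighted V [::] w ms)%:R)%:E))%E.
  apply: eq_esum => ms sz; rewrite word_weight_inflate // FE //.
  rewrite -!EFinM -EFinD; congr (_%:E).
  by rewrite -/(gaps_weight (q 1%N) ms) natrD -muln2 natrM; ring.
rewrite esumD; last 2 first.
- by move=> ms _; rewrite mule_ge0 // lee_fin ?mulr_ge0.
- by move=> ms _; rewrite mule_ge0 // lee_fin ?mulr_ge0.
rewrite !esumZl ?lee_fin ?mulr_ge0 //; last by move=> ms; rewrite lee_fin mulr_ge0.
rewrite esum_gaps_weight // mule1 esum_weighted //; congr (_ + _)%E.
by rewrite !EFinM muleACA muleC.
Qed.

Definition occupied (k : nat) (u : seq bool) : nat := carrier u k.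

Lemma occupiedS k : (0 < k)%N -> occupied k.+1 = occupied k \o skeleton false.
Proof. by move=> k0; apply/funext => u; rewrite /occupied /= carrierS. Qed.

(** This is [statistics_inflate] averaged over the gaps; the coefficients depend on [q 1] only, so a
    truncation that keeps [q 1] has the same ones. *)
Lemma word_mean_skeleton q V : subunit q ->
  (word_mean q (occupation (V \o skeleton false) [::]) =
    word_mean (q \o S) (occupation V [::]) +
    word_mean (q \o S) (turns V [::]) +
    2%:E * mean_gap (q 1%N) * word_mean (q \o S) (occupation V [::]))%E /\
  (word_mean q (turns (V \o skeleton false) [::]) =
    word_mean (q \o S) (turns V [::]) +
    2%:E * mean_gap (q 1%N) * word_mean (q \o S) (occupation V [::]))%E.
Proof.
move=> q1; rewrite -word_meanD; last exact: subunitS.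
by split; apply: word_mean_inflate => // w ms _ sz;
  have [] := @statistics_inflate V [::] [::] w ms sz erefl erefl.
Qed.

(** The case [V = 0], in which no gap is weighted. It carries the normalization to the shifted
    parameters in the induction. *)
Lemma word_mean_mass q : subunit q ->
  word_mean q (fun=> 1%N) = word_mean (q \o S) (fun=> 1%N).
Proof.
move=> q1.
have w0 u w ms : weighted (fun=> 0%N) u w ms = 0%N.
  by elim: w u ms => [|b w IH] u [|m ms] //=; rewrite IH.
have o0 u w : occupation (fun=> 0%N) u w = 0%N.
  by elim: w u => //= b w IH u; rewrite IH.
rewrite (@word_mean_inflate q (fun=> 0%N) _ (fun=> 1%N)) //; last first.
  by move=> w ms _ _; rewrite w0.
rewrite [X in (_ + _ * X)%E]esum1 ?mule0 ?adde0 // => w _.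
by rewrite o0 mulr0.
Qed.

(** If the skeleton is nonempty, its own weight vanishes by induction; if it is empty, the single
    gap of a nonempty word is positive and contributes a power of [q 1 = 0]. *)
Lemma word_weight_zero q w : (forall k, (0 < k)%N -> q k = 0) -> dyck 0 w ->
  word_weight q w = (w == [::])%:R.
Proof.
have [n] := ubnP (size w); elim: n w q => // n IH w q szw q0 dw.
have q1 : subunit q by move=> k /q0 ->; rewrite lexx ltr01.
have [->|w0] := eqVneq w [::].
  apply/cvg_lim => //; rewrite [X in X @ \oo --> _](_ : _ = cst 1); first exact: cvg_cst.
  apply/funext => m; rewrite big_nat_cond big1 // => k /andP[/andP[k0 _] _].
  rewrite /soliton_factor solitons_gt_size // q0 // subr0 expr1n mulr1.
  exact: expr0.
have szp := size_skeleton_lt dw w0.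
rewrite word_weight_skeleton // IH ?(leq_trans szp) //; last 2 first.
- by move=> k _; exact: q0.
- exact: dyck_skeleton0.
have [p0|] := eqVneq (skeleton false w) [::]; last by rewrite mulr0.
have := size_gaps false 0 w; have := inflate_skeleton dw; rewrite p0.
case: (gaps _ _ _) => [//|m [|//]] /= wE _.
rewrite big_seq1 q0 //; case: m wE w0 => [<-//|m] _ _.
by rewrite exprS !mul0r.
Qed.

Lemma word_mean_zero q F : (forall k, (0 < k)%N -> q k = 0) ->
  word_mean q F = (F [::])%:R%:E.
Proof.
move=> q0; rewrite /word_mean (esumID [set [::]]); last first.
  by move=> w dw; rewrite lee_fin word_weight_zero // mulr_ge0.
rewrite [X in (_ + X)%E]esum1 ?adde0; last first.
  by move=> w [dw /eqP w0]; rewrite word_weight_zero // (negbTE w0) mul0r.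
rewrite setIidr; last by move=> w ->.
by rewrite esum_set1 word_weight_zero // eqxx mul1r.
Qed.

Lemma truncate_subunit k q : subunit q -> subunit (truncate k q).
Proof.
by move=> q1 l l0; rewrite /truncate; case: ifP => _; rewrite ?q1 // lexx ltr01.
Qed.

(* The two statistics are mapped to linear combinations of each other by the
   removal of the smallest solitons, in the same way for the occupation of a
   seat and for the constant 1, hence the simultaneous induction. *)
Lemma word_mean_truncate k q : subunit q -> word_mean q (fun=> 1%N) = 1%E ->
  (2%:E * word_mean q (occupation (occupied k.+1) [::]) +
    word_mean (truncate k q) (occupation (fun=> 1%N) [::]) =
    word_mean q (occupation (fun=> 1%N) [::]))%E /\
  (2%:E * word_mean q (turns (occupied k.+1) [::]) +
    word_mean (truncate k q) (turns (fun=> 1%N) [::]) =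
    word_mean q (turns (fun=> 1%N) [::]))%E.
Proof.
elim: k q => [|k IH] q q1 mass.
  have q0 l : (0 < l)%N -> truncate 0 q l = 0 by case: l.
  rewrite !(word_mean_zero _ q0) /=.
  have -> : occupied 1 = (fun u => last false u : nat).
    by apply/funext => u; rewrite /occupied carrier1.
  have two (F : seq bool -> nat) : (2%:E * word_mean q F =
      word_mean q (fun w => F w + F w)%N)%E.
    by rewrite word_meanD // -[2]/(1 + 1)%R EFinD ge0_muleDl ?lee_fin // mul1e.
  (* Under zero parameters the mean length is 1 and there are no turns. Writing this 1 as the mean
     of the constant 1 lets both identities be checked word by word. *)
  rewrite !two adde0 -[1%:R%:E]mass -word_meanD //; split.
    apply: eq_word_mean => w dw; rewrite occupation_last occupation1.
    by have := dyck_count dw; rewrite /=; lia.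
  apply: eq_word_mean => w dw; have := turns_last [::] w.
  by rewrite /= (dyck_last dw); lia.
have q1' := subunitS q1; have t1 := truncate_subunit k.+1 q1.
have mass' : word_mean (q \o S) (fun=> 1%N) = 1%E by rewrite -word_mean_mass.
have [IHo IHt] := IH _ q1' mass'.
have tS : truncate k.+1 q \o S = truncate k (q \o S) by [].
have o1 : (fun=> 1%N : nat) = (fun=> 1%N) \o skeleton false by [].
rewrite occupiedS //.
have [-> ->] := word_mean_skeleton (occupied k.+1) q1.
have [-> ->] := word_mean_skeleton (fun=> 1%N) q1.
have [-> ->] := word_mean_skeleton (fun=> 1%N) t1.
rewrite tS -IHo -IHt.
(* The truncation keeps the first parameter, so one coefficient [c] serves all three pairs of means.
   As [c] has not been shown finite, they are combined in the nonnegative extended reals. *)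
have -> : truncate k.+1 q 1%N = q 1%N by rewrite /truncate ltn0Sn.
set c := (2%:E * mean_gap _)%E.
have c0 : (0 <= c)%E by rewrite mule_ge0 // mean_gap_ge0 // q1.
have tq' := truncate_subunit k q1'.
have combine (A B T U : \bar R) : (0 <= A)%E -> (0 <= B)%E -> (0 <= T)%E -> (0 <= U)%E ->
    (2%:E * (B + c * A) + (U + c * T) = 2%:E * B + U + c * (2%:E * A + T))%E.
  move=> A0 B0 T0 U0; have p1 : (0 <= 2%:E * A)%E by rewrite mule_ge0 ?lee_fin.
  have p2 : (0 <= c * A)%E by rewrite mule_ge0.
  rewrite (ge0_muleDr _ p1 T0) (ge0_muleDr _ B0 p2) (muleCA c).
  exact: addeACA.
split; last by rewrite combine // word_mean_ge0.
have ce F : (0 <= c * word_mean (q \o S) F)%E by rewrite mule_ge0 ?word_mean_ge0.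
rewrite -!addeA ge0_muleDr ?adde_ge0 ?ce ?word_mean_ge0 //.
by rewrite addeACA combine ?word_mean_ge0 // !addeA.
Qed.

End word_means.

(** * Measurability *)

Section countable_partition.
Context d (M : measurableType d) (R : realType) (mu : {measure set M -> \bar R}).
Variables (T : countType) (F : T -> set M).
Hypothesis mF : forall t, measurable (F t).
Hypothesis trivF : forall t t' x, F t x -> F t' x -> t = t'.

(** The family reindexed by the codes of [T], so that additivity for sequences applies; a number
    that codes nothing gets the empty set. *)
Let F' (n : nat) : set M := if pickle_inv n is Some t then F t else set0.

Let mF' n : measurable (F' n).
Proof. by rewrite /F'; case: pickle_inv. Qed.

Let F'_pickle t : F' (pickle t) = F t.
Proof. by rewrite /F' pickleK_inv. Qed.

Let F'_notin n : ~ (exists t : T, pickle t = n) -> F' n = set0.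
Proof.
rewrite /F' => nt; case E : (pickle_inv n) => [t|//]; case: nt; exists t.
by have := pickle_invK (T := T) n; rewrite E.
Qed.

Let bigcupF' : \bigcup_t F t = \bigcup_n F' n.
Proof.
apply/seteqP; split=> x [t _ Ftx]; first by exists (pickle t); rewrite ?F'_pickle.
have [[s st]|nt] := pselect (exists s : T, pickle s = t).
  by exists s => //; rewrite -F'_pickle st.
by rewrite F'_notin in Ftx.
Qed.

Let trivF' : trivIset setT F'.
Proof.
move=> m n _ _ [x [Fm Fn]]; move: Fm Fn; rewrite /F'.
case Em : (pickle_inv m) => [t|//]; case En : (pickle_inv n) => [t'|//] Ft Ft'.
have := pickle_invK (T := T) m; have := pickle_invK (T := T) n.
by rewrite Em En /= (trivF Ft Ft') => <- <-.
Qed.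

Let esum_pickle (a : nat -> \bar R) : (forall n, (0 <= a n)%E) ->
  (forall n, ~ (exists t : T, pickle t = n) -> a n = 0%E) ->
  (\sum_(i <oo) a i = \esum_(t in [set: T]) a (pickle t))%E.
Proof.
move=> a0 an; rewrite nneseries_esumT // (esumID [set pickle t | t in [set: T]]) //.
rewrite [X in (_ + X)%E]esum1 ?adde0 => [|n [_ nt]]; last first.
  by apply: an => -[t tn]; apply: nt; exists t.
rewrite setTI esum_image // => t t' _ _.
Qed.

Lemma measure_countable_bigcup :
  (mu (\bigcup_t F t) = \esum_(t in [set: T]) mu (F t))%E.
Proof.
rewrite bigcupF' measure_bigcup //.
rewrite (eq_eseriesl (Q := xpredT)); last by move=> n; rewrite in_setT.
rewrite esum_pickle => [|n|n nt]; [|exact: measure_ge0|by rewrite F'_notin].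
by apply: eq_esum => t _; rewrite F'_pickle.
Qed.

Lemma integral_countable_bigcup (f : M -> \bar R) (c : T -> \bar R) :
  (forall t, (0 <= c t)%E) -> (forall t x, F t x -> f x = c t) ->
  (\int[mu]_(x in \bigcup_t F t) f x = \esum_(t in [set: T]) (c t * mu (F t)))%E.
Proof.
move=> c0 fE.
have F'E n x : F' n x -> exists2 t, pickle t = n & F t x.
  have [[s <-]|nt] := pselect (exists s : T, pickle s = n); last by rewrite F'_notin.
  by rewrite F'_pickle => Fx; exists s.
rewrite bigcupF' ge0_integral_bigcup //; last 2 first.
- move=> _ Y mY.
  rewrite (_ : _ `&` _ = \bigcup_n (if `[< exists2 t : T, pickle t = n & Y (c t) >]
      then F' n else set0)).
    by apply: bigcupT_measurable => n; case: ifP.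
  apply/seteqP; split=> [x [[n _ Fnx] Yx]|x [n _]].
    have [t tn Ftx] := F'E _ _ Fnx; exists n => //.
    by rewrite asboolT //; exists t => //; rewrite -(fE _ _ Ftx).
  case: asboolP => // -[t <- Yt] Fx; rewrite F'_pickle in Fx.
  by split; [exists (pickle t) => //; rewrite F'_pickle|rewrite /= (fE _ _ Fx)].
- by move=> x [n _ /F'E[t _ /fE ->]].
rewrite esum_pickle; last 2 first.
- by move=> n; apply: integral_ge0 => x /F'E[t _ /fE ->].
- by move=> n nt; rewrite F'_notin // integral_set0.
apply: eq_esum => t _; rewrite F'_pickle -integral_cst //.
by apply: eq_integral => x /set_mem /fE ->.
Qed.

End countable_partition.

Section measurability.
Implicit Types (eta : int -> bool).

Lemma countable_bigcapT_measurable d (M : measurableType d) (U : countType)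
    (F : U -> set M) : (forall i, measurable (F i)) -> measurable (\bigcap_i F i).
Proof.
move=> mF; rewrite -[X in measurable X]setCK setC_bigcap.
apply/measurableC/countable_bigcupT_measurable; first exact: countableP.
by move=> i; exact: measurableC.
Qed.

Lemma measurable_ext (A B : set config) :
  measurable A -> (forall eta, A eta <-> B eta) -> measurable B.
Proof. by move=> mA AB; rewrite (_ : B = A) //; apply/seteqP; split=> eta /AB. Qed.

Lemma measurable_letter (x : int) (b : bool) :
  measurable ([set eta | eta x = b] : set config).
Proof.
have m1 : measurable ([set eta | eta x] : set config).
  by apply: sub_sigma_algebra; exists x.
case: b; first exact: m1.
apply: (measurable_ext (measurableC m1)) => eta.
by split=> [/negP/negbTE|/= ->].
Qed.

Lemma measurable_word (a : int) (u : seq bool) :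
  measurable ([set eta | word eta a (size u) = u] : set config).
Proof.
elim: u a => [|b u IH] a; first exact: (measurable_ext measurableT).
apply: (measurable_ext (measurableI _ _ (measurable_letter a b) (IH (a + 1)))).
by move=> eta /=; rewrite wordS; split=> -[-> ->].
Qed.

(** Such a set is the union of the word cylinders that meet it, and there are countably many
    words. *)
Lemma measurable_finite_dependence (P : (int -> bool) -> Prop) (a : int) (n : nat) :
  (forall eta eta', word eta a n = word eta' a n -> P eta -> P eta') ->
  measurable ([set eta | P eta] : set config).
Proof.
move=> dep.
pose F u : set config := if `[< exists2 eta, P eta & word eta a n = u >]
  then [set eta | word eta a (size u) = u] else set0.
apply: (@measurable_ext (\bigcup_u F u)) => [|eta].
  apply: countable_bigcupT_measurable; first exact: countableP.
  by move=> u; rewrite /F; case: ifP => // _; exact: measurable_word.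
split=> [[u _]|Peta]; last first.
  by exists (word eta a n); rewrite // /F asboolT /= ?size_word //; exists eta.
rewrite /F; case: asboolP => // -[eta' Peta' <-]; rewrite /= size_word => eq_w.
exact: dep (esym eq_w) Peta'.
Qed.

Lemma record_natE eta x : is_record eta x <->
  forall n : nat, height (word eta (x - n%:Z) n.+1) < 0.
Proof.
rewrite recordE; split=> [H n|H a z /andP[_ zx]].
  have := H (x - n%:Z) (x - n%:Z); rewrite (_ : absz _ = n); last by lia.
  by apply; rewrite lexx /=; lia.
by have := H (absz (x - z)%R); rewrite (_ : x - _%:Z = z) //; lia.
Qed.

Lemma measurable_record (x : int) :
  measurable ([set eta | is_record eta x] : set config).
Proof.
apply: (@measurable_ext
  (\bigcap_(n : nat) [set eta | height (word eta (x - n%:Z) n.+1) < 0])) => [|eta].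
  apply: countable_bigcapT_measurable => n.
  by apply: (@measurable_finite_dependence _ (x - n%:Z) n.+1) => eta eta' ->.
by rewrite /= record_natE; split=> [H n|H n _]; exact: H.
Qed.

Lemma measurable_records_below :
  measurable ([set eta | records_below eta] : set config).
Proof.
apply: (@measurable_ext
  (\bigcap_(x : int) \bigcup_(n : nat) [set eta | is_record eta (x - n%:Z)]))
    => [|eta].
  apply: countable_bigcapT_measurable => x.
  by apply: bigcupT_measurable => n; exact: measurable_record.
split=> H x => [|_].
  by have [n _ rn] := H x I; exists (x - n%:Z); [lia|].
have [y yx ry] := H x; exists (absz (x - y)%R) => //=.
by rewrite (_ : x - _ = y) //; lia.
Qed.

Lemma measurable_records_above :
  measurable ([set eta | records_above eta] : set config).
Proof.
apply: (@measurable_ext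
  (\bigcap_(x : int) \bigcup_(n : nat) [set eta | is_record eta (x + n%:Z)]))
    => [|eta].
  apply: countable_bigcapT_measurable => x.
  by apply: bigcupT_measurable => n; exact: measurable_record.
split=> H x => [|_].
  by have [n _ rn] := H x I; exists (x + n%:Z); [lia|].
have [y yx ry] := H x; exists (absz (y - x)%R) => //=.
by rewrite (_ : x + _ = y) //; lia.
Qed.

Variable R : realType.

Lemma left_density_word eta n :
  left_density R eta n = n%:R^-1 * \sum_(b <- word eta (- n%:Z) n.+1) b%:R.
Proof.
rewrite /left_density itv_int_cc (_ : 0 + 1 = - n%:Z + n.+1%:Z); last by lia.
by rewrite fsbig_itvco /word /mkseq big_map /index_iota subn0.
Qed.

Lemma word_suffix eta eta' (m n : nat) : (m <= n)%N ->
  word eta (- n%:Z) n.+1 = word eta' (- n%:Z) n.+1 ->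
  word eta (- m%:Z) m.+1 = word eta' (- m%:Z) m.+1.
Proof.
move=> mn; have -> : n.+1 = ((n - m) + m.+1)%N by lia.
rewrite !word_cat => /eqP; rewrite eqseq_cat ?size_word // => /andP[_ /eqP].
by rewrite (_ : - n%:Z + (n - m)%N%:Z = - m%:Z) //; lia.
Qed.

(** A limit below 1/2 expressed with countable quantifiers: the Cauchy criterion, together with an
    eventual bound at a fixed distance below 1/2. Measurability follows from this form. *)
Lemma OmegaE eta : Omega R eta <-> exists j : nat, forall k : nat, exists m : nat,
  forall n : nat, (m <= n)%N ->
    `|left_density R eta m - left_density R eta n| < k.+1%:R^-1 /\
    left_density R eta n <= 2^-1 - j.+1%:R^-1.
Proof.
set u := left_density R eta; split.
  move=> [l l2 ul].
  have [j _ jl] : exists2 j : nat, True & j.+1%:R^-1 < 2^-1 - l :> R.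
    have := near_infty_natSinv_lt (PosNum (ltac:(by rewrite subr_gt0) : 0 < 2^-1 - l)).
    by move=> [j _ /(_ j (leqnn j))] ?; exists j.
  exists j => k.
  have e1 : 0 < k.+1%:R^-1 / 2 :> R by rewrite divr_gt0.
  have e2 : 0 < 2^-1 - l - j.+1%:R^-1 :> R by rewrite subr_gt0.
  have /cvgrPdist_lt/(_ _ e1) near1 := ul.
  have /cvgrPdist_lt/(_ _ e2) near2 := ul.
  have [m _ mP] := filterI near1 near2.
  exists m => n mn; have [h1 h2] := mP n mn; have [h3 _] := mP m (leqnn m).
  split; last first.
    move: h2; rewrite ltr_norml => /andP[+ _]; rewrite -/(u n).
    by move: (j.+1%:R^-1 : R) => c; lra.
  rewrite (_ : u m - u n = (l - u n) - (l - u m)); last by ring.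
  by apply: le_lt_trans (ler_normB _ _) _; rewrite [ltRHS]splitr ltrD.
move=> [j H].
have cu : cvgn u.
  apply/cauchy_cvgP/cauchy_exP => e e0.
  have [k _ /(_ k (leqnn k)) ke] := near_infty_natSinv_lt (PosNum e0).
  have [m Hm] := H k; exists (u m); exists m => // n /= mn.
  by have [h _] := Hm n mn; rewrite /ball /= ; apply: lt_trans h ke.
exists (limn u) => //.
have [m Hm] := H 0%N.
apply: (@le_lt_trans _ _ (2^-1 - j.+1%:R^-1)); last by rewrite ltrBlDr ltrDl.
by apply: limr_le => //; exists m => // n /= /Hm[].
Qed.

Lemma measurable_Omega : measurable (Omega R).
Proof.
rewrite (_ : Omega R = \bigcup_(j : nat) \bigcap_(k : nat) \bigcup_(m : nat)
   \bigcap_(n : nat) [set eta | (m <= n)%N ->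
    `|left_density R eta m - left_density R eta n| < k.+1%:R^-1 /\
    left_density R eta n <= 2^-1 - j.+1%:R^-1]).
  apply: bigcupT_measurable => j; apply: countable_bigcapT_measurable => k.
  apply: bigcupT_measurable => m; apply: countable_bigcapT_measurable => n.
  apply: (@measurable_finite_dependence _ (- n%:Z) n.+1) => eta eta' eq_w H mn.
  by have := H mn; rewrite !left_density_word -eq_w -(word_suffix mn eq_w).
apply/seteqP; split=> eta /=.
  move=> /OmegaE[j H]; exists j => // k _; have [m Hm] := H k.
  by exists m => // n _; exact: Hm.
move=> [j _ H]; apply/OmegaE; exists j => k; have [m _ Hm] := H k I.
by exists m => n; exact: Hm.
Qed.

Lemma Omega_starE : Omega_star R =
  Omega R `&` ([set eta | records_below eta] `&` [set eta | records_above eta]).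
Proof. by congr (_ `&` _); apply/seteqP; split=> eta /fin_num_s_inf. Qed.

Lemma measurable_Omega_star : measurable (Omega_star R).
Proof.
rewrite Omega_starE; apply: measurableI; first exact: measurable_Omega.
by apply: measurableI; [exact: measurable_records_below|exact: measurable_records_above].
Qed.

End measurability.

(** * The first excursion *)

Section concatenation.
Variable e : int -> excursion.

Lemma start0 : start e 0 = 0.
Proof.
rewrite /start (_ : [set` `[0:int, 0[] = set0) ?fsbig_set0 ?subrr //.
by apply/seteqP; split=> y //=; rewrite in_itv /=; lia.
Qed.

Lemma startS i : start e (i + 1) = start e i + (size (e i))%:Z.
Proof.
rewrite /start; set f := fun j => (size (e j))%:Z.
have empty (a b : int) : b <= a -> [set` `[a, b[] = set0.
  by move=> ba; apply/seteqP; split=> y //=; rewrite in_itv /=; lia.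
have [i0|i0] := leP 0 i.
  rewrite !(empty _ 0) ?fsbig_set0 ?subr0; [|lia|lia].
  rewrite (_ : i + 1 = 0 + (absz i).+1%:Z); last by lia.
  rewrite [in RHS](_ : i = 0 + (absz i)%:Z); last by lia.
  by rewrite !fsbig_itvco big_nat_recr //= /f; congr (_ + _); congr (Posz (size (e _))); lia.
rewrite !(empty 0) ?fsbig_set0 ?sub0r; [|lia|lia].
pose n := absz (i + 1)%R.
rewrite [X in [set` `[i, X[]](_ : 0 = i + n.+1%:Z); last by lia.
rewrite [X in [set` `[i + 1, X[]](_ : 0 = i + 1 + n%:Z); last by lia.
rewrite !fsbig_itvco big_nat_recl //= addr0 opprD /f addrAC addNr add0r.
by congr (- _); apply: eq_bigr => j _; congr (Posz (size (e _))); lia.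
Qed.

Lemma start_lt i n : start e i + n%:Z <= start e (i + n%:Z).
Proof.
elim: n => [|n IH]; first by rewrite !addr0.
rewrite (_ : i + n.+1%:Z = i + n%:Z + 1); last by lia.
rewrite startS size_excursion; lia.
Qed.

(** Blocks are disjoint, so the existential in [concatenation] can only be witnessed by block [i]
    and offset [n]. *)
Lemma concatenation_letter i n : (n < size (e i))%N ->
  concatenation e (start e i + n%:Z) = nth false (e i) n.
Proof.
move=> ni; apply/asboolP/idP => [[i' [j [eq_x ej]]]|h]; last by exists i, n.
have ji : (j < size (e i'))%N.
  by rewrite ltnNge; apply/negP => /(nth_default false) h; rewrite h in ej.
have after a b (m m' : nat) : a < b -> (m < size (e a))%N ->
    start e a + m%:Z < start e b + m'%:Z.
  move=> ab ma; have := start_lt (a + 1) (absz (b - (a + 1))%R).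
  by rewrite startS (_ : a + 1 + _ = b); lia.
case: (ltgtP i i') => [ii'|i'i|ii'].
- by have := after _ _ n j ii' ni; rewrite eq_x ltxx.
- by have := after _ _ j n i'i ji; rewrite eq_x ltxx.
- by move: eq_x ej; rewrite -ii' => /addrI [->].
Qed.

Lemma word_concatenation i :
  word (concatenation e) (start e i) (size (e i)) = e i.
Proof.
apply: (@eq_from_nth _ false); rewrite size_word // => n ni.
by rewrite nth_word // concatenation_letter.
Qed.

Lemma word_concatenation_body i :
  word (concatenation e) (start e i + 1) (size (body (e i))) = body (e i).
Proof.
have := word_concatenation i; rewrite size_excursion wordS.
by rewrite [RHS]excursionE => -[].
Qed.

Lemma concatenation_start i : concatenation e (start e i) = false.
Proof.
rewrite -[start e i]addr0 (@concatenation_letter i 0) ?size_excursion //.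
by rewrite excursionE.
Qed.

Lemma concatenation_record i : is_record (concatenation e) (start e i).
Proof.
have rec_from m n : record_from (concatenation e) (start e m) (start e (m + n%:Z)).
  elim: n => [|n IH].
    rewrite addr0 => z zE; have -> : z = start e m by lia.
    by rewrite subrr word1 concatenation_start height_cons height_nil.
  rewrite (_ : m + n.+1%:Z = m + n%:Z + 1); last by lia.
  set j := m + n%:Z in IH *.
  have sE : start e (j + 1) = start e j + 1 + (size (body (e j)))%:Z.
    by rewrite startS size_excursion; lia.
  rewrite sE; apply: record_after => //; last by rewrite -sE concatenation_start.
  by rewrite word_concatenation_body dyck_body.
apply/recordE => a z /andP[az zi].
(* Every block has at least one letter, so block [i - n] starts at or before [a], and the induction
   can begin there. *)
pose n := absz (start e i - a)%R.
have := rec_from (i - n%:Z) n; rewrite subrK; apply.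
have := start_lt (i - n%:Z) n; rewrite subrK; lia.
Qed.

End concatenation.

(** The record required at the end of [e] is what makes [e] unique. *)
Definition begins_with (e : excursion) : set config :=
  [set eta | [/\ is_record eta 0, is_record eta (size e)%:Z &
                 word eta 0 (size e) = e]].

Lemma begins_with_body e eta : begins_with e eta ->
  word eta (0 + 1) (size (body e)) = body e.
Proof. by case=> _ _; rewrite size_excursion wordS [RHS]excursionE => -[]. Qed.

(** Were one excursion shorter, the record at its end would fall inside the other, against
    [not_record]. *)
Lemma begins_with_inj e e' eta :
  begins_with e eta -> begins_with e' eta -> e = e'.
Proof.
suff le a b : begins_with a eta -> begins_with b eta -> (size b <= size a)%N.
  move=> be be'; have sz : size e = size e'.
    by apply/eqP; rewrite eqn_leq !le.
  have [_ _ w] := be; have [_ _ w'] := be'.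
  by apply: val_inj => /=; rewrite -w -w' sz.
move=> ba bb; rewrite leqNgt; apply/negP => ab.
have [_ ra _] := ba; have bodyb := begins_with_body bb.
apply: (@not_record eta 0 (size (body a)) (size (body b))).
- by move: ab; rewrite !size_excursion.
- by rewrite bodyb dyck_body.
- by move: ra; rewrite size_excursion (_ : 0 + 1 + _%:Z = (size (body a)).+1%:Z) //; lia.
Qed.

Lemma concatenation_begins_with e : begins_with (e 0) (concatenation e).
Proof.
have r := @concatenation_record e; split.
- by have := r 0; rewrite start0.
- by have := r (0 + 1); rewrite startS start0 add0r.
- by have := word_concatenation e 0; rewrite start0.
Qed.

Lemma measurable_begins_with e : measurable (begins_with e).
Proof.
have m3 := measurableI _ _ (measurableI _ _ (measurable_record 0)
  (measurable_record (size e)%:Z)) (measurable_word 0 e).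
apply: (measurable_ext m3) => eta.
by split=> [[[]]|[]].
Qed.

Section record_sites.
Variable R : realType.

Lemma Omega_rE : Omega_r R = Omega_star R `&` [set eta | is_record eta 0].
Proof.
apply/seteqP; split=> eta [st /= h]; split=> //=.
  have [_ /(_ 0) fin] := st; have enum := fin_num_s_inf_enum fin.
  by have [rec _ _ _] := enum; apply/rec; exists 0.
have [_ /(_ 0) fin] := st; have enum := fin_num_s_inf_enum fin.
have [r [-> _ r0 rmax]] := enum_first enum.
congr (_%:E); apply/eqP; rewrite eq_le r0 leNgt; apply/negP => rneg.
by apply: (rmax 0) => //; rewrite rneg lexx.
Qed.

Lemma measurable_Omega_r : measurable (Omega_r R).
Proof.
rewrite Omega_rE; apply: measurableI; first exact: measurable_Omega_star.
exact: measurable_record.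
Qed.

Lemma Omega_r_below eta : Omega_r R eta -> records_below eta.
Proof. by case=> -[_ /fin_num_s_inf[]]. Qed.

Lemma Omega_r_begins_with eta : Omega_r R eta ->
  exists2 e, begins_with e eta & fine (s_inf eta 1) = (size e)%:Z.
Proof.
move=> [[_ fin] /= s0]; have enum := fin_num_s_inf_enum (fin 0).
have [r1 s1] : exists r, s_inf eta 1 = r%:E.
  by exists (fine (s_inf eta 1)); rewrite fineK.
have [rr' r0 nrec] := enum_second enum s0 s1.
have [r [sr rr _ _]] := enum_first enum.
have rr0 : is_record eta 0 by move: sr rr; rewrite s0 => -[->].
pose n := absz (r1 - 1)%R; have r1E : r1 = 0 + 1 + n%:Z by lia.
have dw : dyck 0 (word eta (0 + 1) n).
  by apply: between_records; rewrite -?r1E // => m mn; apply: nrec; lia.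
have we : is_excursion (word eta 0 n.+1).
  apply/excursionP; exists (word eta (0 + 1) n) => //.
  by rewrite wordS (record_letter rr0).
have sz : size (Excursion we) = n.+1 by exact: size_word.
exists (Excursion we); last by rewrite s1 sz /=; lia.
by split; rewrite ?sz // (_ : n.+1%:Z = r1) //; lia.
Qed.

End record_sites.

Lemma occupationE V u w :
  occupation V u w = (\sum_(0 <= n < (size w).+1) V (u ++ take n w))%N.
Proof.
elim: w u => [|b w IH] u /=; first by rewrite big_nat1 /= cats0 addn0.
rewrite big_ltn // take0 cats0 big_add1 /= IH; congr (_ + _)%N.
by apply: eq_bigr => n _; rewrite cat_rcons.
Qed.

Lemma seat_begins_with e eta k (n : nat) : (0 < k)%N ->
    records_below eta -> begins_with e eta -> (n < size e)%N ->
  seat (Defs.shift n%:Z eta) k 0 = carrier (take n (body e)) k.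
Proof.
move=> k0 below be ne; have [r0 _ _] := be.
have below' : records_below (Defs.shift n%:Z eta).
  move=> x; have [y yx ry] := below (x + n%:Z); exists (y - n%:Z); first by lia.
  by apply/is_record_shift; rewrite subrK.
have r' : is_record (Defs.shift n%:Z eta) (- n%:Z).
  by apply/is_record_shift; rewrite addNr.
rewrite -[X in seat _ _ X](addNr n%:Z) seatE // word_shift.
rewrite (_ : - n%:Z + 1 + n%:Z = 0 + 1); last by lia.
rewrite -(begins_with_body be) take_word //.
by move: ne; rewrite size_excursion.
Qed.

(** By [seatE] the seat is read off the word [u] between any record at or before 0 and the site 0;
    the event is a countable union over [u]. *)
Lemma measurable_seat k : (0 < k)%N ->
  measurable ([set eta | records_below eta /\ seat eta k 0] : set config).
Proof.
move=> k0.
pose F (u : seq bool) : set config := if carrier u k then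
  [set eta | is_record eta (- (size u)%:Z)] `&`
  [set eta | word eta (- (size u)%:Z + 1) (size u) = u] else set0.
have mF : measurable (\bigcup_u F u).
  apply: countable_bigcupT_measurable; first exact: countableP.
  move=> u; rewrite /F; case: ifP => // _.
  by apply: measurableI; [exact: measurable_record|exact: measurable_word].
apply: (measurable_ext (measurableI _ _ measurable_records_below mF)) => eta.
split=> -[below]; last first.
  have [n [rn _]] := last_record 0 below; rewrite sub0r in rn.
  move=> sk; split => //; exists (word eta (- n%:Z + 1) n) => //.
  rewrite /F size_word -(seatE n below rn k0) addNr sk; split=> //.
case=> u _; rewrite /F; case: ifP => // uk [ru wu]; split=> //.
by rewrite -(addNr (size u)%:Z) (seatE (size u) below ru k0) wu.
Qed.

(** * Integrals under the two measures as means over excursions *)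

Section excursion_means.
Variable R : realType.
Implicit Types (q : nat -> R).

Lemma word_meanE q F : subunit q ->
  word_mean q F =
  (\esum_(e in [set: excursion]) ((F (body e))%:R * exc_weight q e)%:E)%E.
Proof.
move=> q1; rewrite /word_mean (reindex_esum _ _ _ _ set_bij_body).
by apply: eq_esum => e _; rewrite exc_weightE mulrC.
Qed.

Lemma mean_lengthE q : subunit q ->
  mean_length q = fine (word_mean q (occupation (fun=> 1%N) [::])).
Proof.
move=> q1; rewrite word_meanE // /mean_length; congr fine.
by apply: eq_esum => e _; rewrite occupation1 size_excursion.
Qed.

Section phi_hat.
Variables (q : nat -> R) (phi_hat : probability config R).
Hypothesis q1 : subunit q.
Hypothesis hphi_hat : is_phi_hat q phi_hat.

Lemma phi_hat_begins_with e : phi_hat (begins_with e) = (exc_weight q e)%:E.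
Proof.
have [d [T [P [X [[_ PX _] phiE]]]]] := hphi_hat.
rewrite phiE; last exact: measurable_begins_with.
rewrite -(PX 0 e); congr (P _); apply/seteqP; split=> t /=.
  exact: begins_with_inj (concatenation_begins_with _).
by move=> <-; exact: concatenation_begins_with.
Qed.

(** The normalization of the weights comes from the random excursion [X 0], whose law they are. *)
Lemma word_mean_mass1 : word_mean q (fun=> 1%N) = 1%E.
Proof.
have [d [T [P [X [[mX PX _] _]]]]] := hphi_hat.
rewrite word_meanE // -(probability_setT P).
have -> : [set: T] = \bigcup_(e : excursion) (X 0 @^-1` [set e]).
  by apply/seteqP; split=> // t _; exists (X 0 t).
rewrite measure_countable_bigcup //; last by move=> e e' t /= <- <-.
by apply: eq_esum => e _; rewrite mul1r -(PX 0 e).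
Qed.

(** The law of the first excursion restricted to [Omega_r]; [m_exc_weight] shows that the
    restriction loses no mass. *)
Let m e := phi_hat (Omega_r R `&` begins_with e).

Lemma integral_first_excursion (f : config -> \bar R) (c : excursion -> \bar R) :
  (forall e, (0 <= c e)%E) ->
  (forall e eta, Omega_r R eta -> begins_with e eta ->
    fine (s_inf eta 1) = (size e)%:Z -> f eta = c e) ->
  (\int[phi_hat]_(eta in Omega_r R) f eta =
   \esum_(e in [set: excursion]) (c e * m e))%E.
Proof.
move=> c0 fE.
rewrite {1}(_ : Omega_r R = \bigcup_e (Omega_r R `&` begins_with e)); last first.
  apply/seteqP; split=> [eta oeta|eta [e _ []//]].
  by have [e be _] := Omega_r_begins_with oeta; exists e.
apply: integral_countable_bigcup => //.
- by move=> e; apply: measurableI; [exact: measurable_Omega_r|exact: measurable_begins_with].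
- by move=> e e' eta [_ be] [_ be']; exact: begins_with_inj be be'.
- move=> e eta [oeta be]; apply: (fE e) => //.
  have [e' be' ->] := Omega_r_begins_with oeta.
  by rewrite (begins_with_inj be be').
Qed.

Variable phi : probability config R.
Hypothesis hphi : is_phi q phi_hat phi.

Let L := word_mean q (occupation (fun=> 1%N) [::]).

Lemma mean_length_mass :
  (1 = (mean_length q)^-1%:E * \esum_(e in [set: excursion]) ((size e)%:R%:E * m e))%E.
Proof.
have [phi1 /(_ (cst 1%E))] := hphi.
move=> /(_ (measurable_cst _) (fun _ _ => lee01)).
rewrite integral_cst ?mul1e; last exact: measurable_Omega_star.
move=> phi_eq; apply: etrans (esym phi1) _; apply: etrans phi_eq _.
congr (_ * _)%E.
apply: integral_first_excursion => [e|e eta _ _ ->]; first by rewrite lee_fin.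
rewrite -[(size e)%:Z]add0r fsbig_itvco /cst big_const_nat subn0.
by elim: (size e) => //= n ->; rewrite -natr1 addrC EFinD.
Qed.

(** The inverse of 0 is 0, so a vanishing mean length would turn [mean_length_mass] into [1 = 0]. *)
Lemma mean_length_neq0 : mean_length q != 0.
Proof.
apply/eqP => ml0; have := mean_length_mass; rewrite ml0 invr0 mul0e.
by move/eqP; rewrite onee_eq0.
Qed.

(** Since [fine] sends an infinite sum to 0, a nonzero mean length forces the sum to be finite. *)
Lemma mean_length_fin : L = (mean_length q)%:E.
Proof.
have := mean_length_neq0; rewrite mean_lengthE // -/L.
by case: L => [r||] //=; rewrite eqxx.
Qed.

(** The sizes have the same finite sum against [m] and against the weights, by [mean_length_mass].
    As [m] is at most the weight and sizes are positive, the lost mass [r] vanishes for each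
    excursion. *)
Lemma m_exc_weight e : m e = (exc_weight q e)%:E.
Proof.
pose r e := phi_hat (begins_with e `\` Omega_r R).
have mb := measurable_begins_with; have mo := measurable_Omega_r R.
have split_e e' : ((exc_weight q e')%:E = m e' + r e')%E.
  rewrite -phi_hat_begins_with (measureDI _ (mb e') mo) addeC.
  by rewrite /m setIC.
have m0 e' : (0 <= m e')%E by exact: measure_ge0.
have r0 e' : (0 <= r e')%E by exact: measure_ge0.
have M : (\esum_(e in [set: excursion]) ((size e)%:R%:E * m e) = L)%E.
  rewrite mean_length_fin -[RHS]mule1 mean_length_mass muleA -EFinM.
  by rewrite mulfV ?mul1e // mean_length_neq0.
have LE : (L = \esum_(e in [set: excursion]) ((size e)%:R%:E * m e) +
    \esum_(e in [set: excursion]) ((size e)%:R%:E * r e))%E.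
  rewrite -esumD; last 2 first.
  - by move=> e' _; rewrite mule_ge0 // lee_fin.
  - by move=> e' _; rewrite mule_ge0 // lee_fin.
  rewrite /L word_meanE //; apply: eq_esum => e' _.
  by rewrite occupation1 -size_excursion EFinM split_e ge0_muleDr.
have : (\esum_(e in [set: excursion]) ((size e)%:R%:E * r e) = 0)%E.
  move: LE; rewrite M mean_length_fin.
  case: (esum _ _) => [s||] //= /eqP; rewrite -EFinD eqe -subr_eq0.
  by rewrite opprD addrA subrr sub0r oppr_eq0 => /eqP ->.
have : ((size e)%:R%:E * r e <= \esum_(e in [set: excursion]) ((size e)%:R%:E * r e))%E.
  apply: esum_ge; exists [set e]; first by split=> //; exact: finite_set1.
  by rewrite fsbig_set1.
move=> /[swap] ->; have := r0 e; rewrite split_e.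
have : (0 < (size e)%:R%:E :> \bar R)%E by rewrite lte_fin size_excursion ltr0n.
move=> se re; rewrite pmule_rle0 // => re'.
by rewrite [r e](_ : _ = 0%E) ?adde0 //; apply/eqP; rewrite eq_le re'.
Qed.

Lemma integral_seat k : (0 < k)%N ->
  (\int[phi]_(eta in Omega_star R) ((seat eta k 0)%:R)%:E =
   (mean_length q)^-1%:E * word_mean q (occupation (occupied k) [::]))%E.
Proof.
move=> k0.
pose f (eta : config) : \bar R := ((seat eta k 0)%:R)%:E.
(* On [Omega_star] the function [f] is the indicator of [S], which is measurable on the whole
   space. *)
pose S : set config := [set eta | records_below eta /\ seat eta k 0].
have mS : measurable S by exact: measurable_seat.
have mf : measurable_fun (Omega_star R) f.
  apply: (eq_measurable_fun (EFin \o (\1_S : config -> R))).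
    move=> eta /set_mem oeta; rewrite /f /= indicE; congr ((nat_of_bool _)%:R%:E).
    have below : records_below eta by case: oeta => _ /fin_num_s_inf[].
    by apply/idP/idP => [/set_mem[]//|h]; rewrite inE.
  by apply/measurable_EFinP; apply: measurable_funTS; exact: measurable_indic.
have [_ /(_ f mf)] := hphi.
move=> /(_ (fun eta _ => _)) -> ; last by move=> eta; rewrite lee_fin.
congr (_ * _)%E.
rewrite word_meanE //.
rewrite (integral_first_excursion
  (c := fun e => (occupation (occupied k) [::] (body e))%:R%:E)).
- by apply: eq_esum => e _; rewrite m_exc_weight EFinM.
- by move=> e; rewrite lee_fin.
move=> e eta oeta be ->.
rewrite -[(size e)%:Z]add0r fsbig_itvco size_excursion occupationE natr_sum -sumEFin.
apply: eq_big_nat => n /andP[_ ne].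
rewrite /f add0r (seat_begins_with k0 (Omega_r_below oeta) be) //.
by rewrite size_excursion.
Qed.

End phi_hat.
End excursion_means.

Theorem proposition5p21 (R : realType) (q : nat -> R) (hq : Qplus q)
    (phi_hat phi : probability config R)
    (hphi_hat : is_phi_hat q phi_hat) (hphi : is_phi q phi_hat phi)
    (k : nat) (hk : (0 < k)%N) :
  (\int[phi]_(eta in Omega_star R) ((seat eta k 0)%:R)%:E)%E =
  ((mean_length q - mean_length (truncate k.-1 q)) / (2 * mean_length q))%:E.
Proof.
have q1 : subunit q by case: hq.
rewrite (integral_seat q1 hphi_hat hphi hk).
case: k hk => // k _.
have ml0 := mean_length_neq0 hphi.
have Lfin := mean_length_fin q1 hphi.
have [main _] := word_mean_truncate k q1 (word_mean_mass1 q1 hphi_hat).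
rewrite (mean_lengthE (truncate_subunit k q1)).
move: main; rewrite Lfin; move: (mean_length q) ml0 => ml ml0.
set x := word_mean q _; set t := word_mean (truncate k q) _ => main.
(* The sum is the finite mean length, so both terms are finite and the identity can be solved in
   [R]. *)
have : (2%:E * x + t)%E \is a fin_num by rewrite main.
rewrite fin_numD => /andP[fin_x fin_t].
have x_fin : x \is a fin_num.
  case: x fin_x {main} => [//||].
    by rewrite gt0_muley ?lte_fin.
  by rewrite gt0_muleNy ?lte_fin.
move: main; rewrite -(fineK x_fin) -(fineK fin_t) -!EFinM -EFinD /= => -[mlE].
congr (_%:E); move: ml0; rewrite -mlE => ml0.
by field.
Qed.
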